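(* Suppose a finitely generated group $G$ admits a subsequence of controlled Følner pairs. Then $G$ has property $H_{\mathrm{FD}}$.
   Context: Let $G$ be a finitely generated group with word metric $d$ with respect to a finite symmetric generating set, and $B(e,r)$ the ball of radius $r$ around the identity. $G$ admits a subsequence of controlled Følner pairs if there are a constant $C<\infty$, an infinite sequence of integers $n_i\to\infty$, and pairs of finite non-empty subsets $F'_{n_i}\subset F_{n_i}$ of $G$ such that for all $i$: (i) $\#F_{n_i}\le C\,\#F'_{n_i}$; (ii) $d(F'_{n_i},G\setminus F_{n_i})\ge n_i$; (iii') $F_{n_i}\subset B(e,Cn_i)$. A group $G$ has (Shalom's) property $H_{\mathrm{FD}}$ if every orthogonal $G$-representation $\pi$ (on a real Hilbert space) with non-zero reduced first cohomology $\overline H^1(G,\pi)$ admits a (non-zero) finite-dimensional sub-representation. *)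

(* Defs.v *)
From HB Require Import structures.
From mathcomp Require Import all_boot all_order all_algebra finmap.
From mathcomp Require Import all_classical all_reals all_analysis.
Set Implicit Arguments.
Unset Strict Implicit.
Unset Printing Implicit Defensive.
Import Order.TTheory GRing.Theory Num.Theory.
Import numFieldNormedType.Exports.
Local Open Scope classical_set_scope.
Local Open Scope ring_scope.

Section WordMetric.
Variables (G : groupType) (S : {fset G}).

Definition symmetric_set : Prop := forall s, s \in S -> (s^-1)%g \in S.

(* [g] is a product of [n] elements of [S]. *)
Definition spelled_in (g : G) (n : nat) : Prop :=
  exists w : seq G,
    [/\ {subset w <= S}, size w = n & (\prod_(s <- w) s)%g = g].

(* For a symmetric [S], words in [S] suffice: no formal inverses are needed. *)
Definition generating : Prop := forall g, exists n, spelled_in g n.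

Hypothesis genS : generating.

Lemma spelled_in_asbool g : exists n, `[< spelled_in g n >].
Proof. by have [n gn] := genS g; exists n; apply/asboolP. Qed.

Definition word_length (g : G) : nat := ex_minn (spelled_in_asbool g).

(* The left-invariant word metric. *)
Definition word_dist (g h : G) : nat := word_length (g^-1 * h)%g.

Definition word_ball (R : realType) (g : G) (r : R) : set G :=
  [set h | (word_dist g h)%:R <= r].

(* The infimum is taken in the extended reals, so that the distance to the
   empty set is [+oo]; this matters when [G] is finite and [F = G]. *)
Definition set_dist (R : realType) (A B : set G) : \bar R :=
  ereal_inf [set ((word_dist x y)%:R : R)%:E | x in A & y in B].

Definition controlled_Folner_pairs (R : realType) : Prop :=
  exists (C : R) (n : nat -> nat) (F' F : nat -> {fset G}),
    n @ \oo --> \oo /\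
    forall i,
      [/\ F' i != fset0, F i != fset0 & (F' i `<=` F i)%fset] /\
      [/\ (#|` F i|%:R <= C * #|` F' i|%:R),
          (((n i)%:R : R)%:E <= set_dist R [set` F' i] (~` [set` F i]))%E
        & [set` F i] `<=` word_ball 1%g (C * (n i)%:R)].

End WordMetric.

Section Representations.
Variables (R : realType) (G : groupType).

(* With [V] complete, this makes [V] a real Hilbert space. *)
Definition induces_norm (V : normedModType R) (dot : {dot V for idfun}) : Prop :=
  forall v : V, `|v| ^+ 2 = dot v v.

Definition orthogonal_rep (V : lmodType R) (dot : {dot V for idfun})
    (pi : G -> {linear V -> V}) : Prop :=
  [/\ forall v, pi 1%g v = v,
      forall g h v, pi (g * h)%g v = pi g (pi h v)
    & forall g u v, dot (pi g u) (pi g v) = dot u v].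

Section Cohomology.
Variables (V : normedModType R) (pi : G -> {linear V -> V}).

Definition cocycles : set {ptws G -> V} :=
  [set b | forall g h, b (g * h)%g = b g + pi g (b h)].

Definition coboundaries : set {ptws G -> V} :=
  [set b | exists v, forall g, b g = pi g v - v].

(* The reduced first cohomology is the quotient of the cocycles by the closure
   of the coboundaries, for pointwise convergence on the discrete group [G]. *)
Definition nonzero_reduced_H1 : Prop :=
  cocycles `\` closure coboundaries !=set0.

Definition finite_dim_subspace (W : set V) : Prop :=
  exists (k : nat) (e : 'I_k -> V),
    W = [set v | exists a : 'I_k -> R, v = \sum_(i < k) a i *: e i].

Definition subrepresentation (W : set V) : Prop :=
  forall g v, W v -> W (pi g v).

Definition has_finite_dim_subrep : Prop :=
  exists W : set V,
    [/\ finite_dim_subspace W, subrepresentation W & W <> [set 0]].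

End Cohomology.

Definition property_HFD : Prop :=
  forall (V : completeNormedModType R) (dot : {dot V for idfun})
         (pi : G -> {linear V -> V}),
    induces_norm dot -> orthogonal_rep dot pi ->
    nonzero_reduced_H1 pi -> has_finite_dim_subrep pi.

End Representations.

(* Main.v *)
Require Import Defs.
From HB Require Import structures.
From mathcomp Require Import all_boot all_order all_algebra finmap.
From mathcomp Require Import all_classical all_reals all_analysis.
From mathcomp Require Import ring lra.
Set Implicit Arguments.
Unset Strict Implicit.
Unset Printing Implicit Defensive.
Import Order.TTheory GRing.Theory Num.Theory.
Import numFieldNormedType.Exports.
Local Open Scope classical_set_scope.
Local Open Scope ring_scope.

(** The theorem is proved with the simple random walk of the finite generating set,
    following the idea of Erschler and Ozawa that in a representation without
    finite-dimensional subrepresentations the norm of a harmonic cocycle along the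
    walk concentrates, which is incompatible with the recurrence to balls that
    controlled Folner pairs force.

    A nonzero class in reduced cohomology contains, up to limits of coboundaries, a
    nonzero cocycle [b] with zero sum over the generators: the minimiser of the
    energy ([ex_harmonic]). Such a [b] is a martingale along the walk, so the mean
    of [|b|^2] at time [t] is [t * drift] exactly ([walk_energy]).

    Let [(F', F)] be a Folner pair at scale [n]. A plateau function over [F'] shows
    that the walk stays in [F] for a time [t] of order [n^2] with probability
    bounded below ([folner_return]). Between two points of [F] the walk has moved by
    an element of length [O(n)], on which [|b|^2 = O(n^2)]; taking [t] a large
    multiple of [n^2], this is less than half of the mean. Hence the variance of
    [|b|^2] at such times is at least a constant times [t^2] ([energy_dev_ge]).

    On the other hand [|b|^2 - t * drift] is a martingale whose increments are
    controlled by the coordinates of [b] along the vectors [b s], so its variance is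
    at most [t] times the second moments of these coordinates ([energy_dev_le]),
    which therefore grow linearly along a sequence of times ([ex_linear_growth]).

    Dividing the second moments by the time and passing to the limit along an
    ultrafilter gives a quadratic form [q] on the Hilbert space: nonzero by the
    linear growth, of trace at most [drift] by Bessel's inequality, and
    subharmonic under the generators by conditioning on the first step
    ([limit_form_mean_le]). A form of finite trace attains its supremum on the unit
    sphere, on a finite-dimensional subspace ([eigenspace_neq0],
    [finite_dim_eigenspace]), and subharmonicity makes this subspace invariant
    ([finite_dim_of_limit_form]). *)

(** * Inner products and orthonormal families *)

Section InnerProduct.
Variables (R : realType) (V : lmodType R) (dot : {dot V for idfun}).
Implicit Types (u v w : V) (a : R) (l : seq V).

Lemma dotC u v : dot u v = dot v u.
Proof. by rewrite hermC /= expr0 mul1r. Qed.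

Lemma dotDl u v w : dot (u + v) w = dot u w + dot v w.
Proof. exact: linearDl. Qed.

Lemma dotDr u v w : dot w (u + v) = dot w u + dot w v.
Proof. by rewrite ![dot w _]dotC dotDl. Qed.

Lemma dotZl a u v : dot (a *: u) v = a * dot u v.
Proof. exact: linearZl_LR. Qed.

Lemma dotZr a u v : dot u (a *: v) = a * dot u v.
Proof. by rewrite ![dot u _]dotC dotZl. Qed.

Lemma dotNl u v : dot (- u) v = - dot u v.
Proof. by rewrite -scaleN1r dotZl mulN1r. Qed.

Lemma dotNr u v : dot u (- v) = - dot u v.
Proof. by rewrite -scaleN1r dotZr mulN1r. Qed.

Lemma dot0l u : dot 0 u = 0.
Proof. by rewrite -(scale0r 0) dotZl mul0r. Qed.

Lemma dot0r u : dot u 0 = 0.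
Proof. by rewrite dotC dot0l. Qed.

Lemma dot_suml (I : Type) (r : seq I) (F : I -> V) u :
  dot (\sum_(i <- r) F i) u = \sum_(i <- r) dot (F i) u.
Proof.
by elim/big_rec2: _ => [|i x y _ <-]; rewrite ?dot0l // dotDl.
Qed.

Lemma dot_ge0 u : 0 <= dot u u.
Proof.
have [->|u0] := eqVneq u 0; first by rewrite dot0l.
exact/ltW/neq0_dnorm_gt0.
Qed.

Lemma dot_eq0 u : (dot u u == 0) = (u == 0).
Proof.
have [->|u0] := eqVneq u 0; first by rewrite dot0l eqxx.
by rewrite gt_eqF // neq0_dnorm_gt0.
Qed.

Lemma dot_gt0 u : u != 0 -> 0 < dot u u.
Proof. exact: neq0_dnorm_gt0. Qed.

Lemma dot_parallelogram u v :
  dot (u + v) (u + v) + dot (u - v) (u - v) = 2 * (dot u u + dot v v).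
Proof. by rewrite !(dotDl, dotDr, dotNl, dotNr); ring. Qed.

Lemma dot_addr_le u v :
  dot (u + v) (u + v) <= 2 * dot u u + 2 * dot v v.
Proof.
by have := dot_parallelogram u v; have := dot_ge0 (u - v); lra.
Qed.

Lemma dot_subr_le u v :
  dot (u - v) (u - v) <= 2 * dot u u + 2 * dot v v.
Proof.
by have := dot_parallelogram u v; have := dot_ge0 (u + v); lra.
Qed.

Definition orthonormal_seq l :=
  all (fun u => dot u u == 1) l && pairwise (fun u v => dot u v == 0) l.

Definition proj l v : V := \sum_(e <- l) dot v e *: e.

Lemma orthonormal_cons u l : orthonormal_seq (u :: l) =
  [&& dot u u == 1, all (fun e => dot u e == 0) l & orthonormal_seq l].
Proof. by rewrite /orthonormal_seq /= -andbA; congr andb; rewrite andbCA. Qed.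

Lemma dot_proj l v e : orthonormal_seq l -> e \in l ->
  dot (proj l v) e = dot v e.
Proof.
rewrite /proj; elim: l => // f l IH; rewrite orthonormal_cons.
move=> /and3P[/eqP f1 /allP fl ol]; rewrite inE big_cons dotDl dotZl.
case/orP => [/eqP ->|el].
  rewrite f1 mulr1 dot_suml big_seq big1 ?addr0 // => g gl.
  by rewrite dotZl [X in _ * X]dotC (eqP (fl g gl)) mulr0.
by rewrite (eqP (fl e el)) mulr0 add0r IH.
Qed.

Lemma dot_sub_proj l v e : orthonormal_seq l -> e \in l ->
  dot (v - proj l v) e = 0.
Proof. by move=> ol el; rewrite dotDl dotNl dot_proj // subrr. Qed.

Lemma dot_projr l v w :
  dot w (proj l v) = \sum_(e <- l) dot v e * dot w e.
Proof.
rewrite dotC dot_suml; apply: eq_bigr => e _.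
by rewrite dotZl [X in _ * X]dotC.
Qed.

Lemma bessel l v : orthonormal_seq l ->
  \sum_(e <- l) dot v e ^+ 2 <= dot v v.
Proof.
move=> ol; have := dot_ge0 (v - proj l v).
rewrite dotDr dotNr [dot _ (proj _ _)]dot_projr big_seq big1; last first.
  by move=> e el; rewrite dot_sub_proj // mulr0.
rewrite dotDl dotNl [dot (proj l v) v]dotC dot_projr subr0 subr_ge0.
by under eq_bigr do rewrite -expr2.
Qed.

Lemma cauchy_schwarz u v : dot u v ^+ 2 <= dot u u * dot v v.
Proof.
have [->|v0] := eqVneq v 0; first by rewrite !dot0r expr0n /= mulr0.
have vv := dot_gt0 v0.
have := dot_ge0 (dot v v *: u - dot u v *: v).
rewrite !(dotDl, dotDr, dotNl, dotNr, dotZl, dotZr) [dot v u]dotC => h.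
rewrite -subr_ge0 -(pmulr_rge0 _ vv); apply: le_trans h _.
by rewrite le_eqVlt; apply/orP; left; apply/eqP; ring.
Qed.

Lemma ex_unit v : v != 0 -> exists a, a != 0 /\ dot (a *: v) (a *: v) = 1.
Proof.
move=> v0; have vv := dot_gt0 v0; exists (Num.sqrt (dot v v))^-1.
have s0 : 0 < Num.sqrt (dot v v) by rewrite sqrtr_gt0.
split; first by rewrite invr_eq0 gt_eqF.
rewrite dotZl dotZr mulrA -invfM -expr2 sqr_sqrtr ?(ltW vv)// mulVf //.
by rewrite gt_eqF.
Qed.

(** A bound on the length of orthonormal families in [A] plays the part of
    finite dimension: a longest family exists, and a unit vector of [A] orthogonal
    to it would lengthen it. *)
Lemma ex_max_orthonormal (A : set V) (N : nat) :
  (forall l, orthonormal_seq l -> (forall e, e \in l -> A e) -> (size l <= N)%N) ->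
  exists l, [/\ orthonormal_seq l, forall e, e \in l -> A e &
    forall v, A v -> dot v v = 1 -> ~ (forall e, e \in l -> dot v e = 0)].
Proof.
move=> bound.
pose P n := `[< exists l, [/\ orthonormal_seq l, forall e, e \in l -> A e
  & size l = n] >].
have exP : exists n, P n by exists 0; apply/asboolP; exists [::].
have ubP n : P n -> (n <= N)%N.
  by move=> /asboolP[l [ol Al <-]]; exact: bound.
have [n /asboolP[l [ol Al sl]] maxn] := ex_maxnP exP ubP.
exists l; split => // v Av v1 vl.
have : P n.+1.
  apply/asboolP; exists (v :: l); split; last by rewrite /= sl.
    rewrite orthonormal_cons v1 eqxx ol andbT /=.
    by apply/allP => e /vl ->.
  by move=> e; rewrite inE => /orP[/eqP -> //|]; exact: Al.
by move=> /maxn; rewrite ltnn.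
Qed.

End InnerProduct.

(** * Limits along ultrafilters *)

Section UltraLimit.
Variable (R : realType).

Lemma ultra_fmap (T T' : Type) (f : T -> T') (U : set_system T) :
  UltraFilter U -> UltraFilter (f @ U).
Proof.
move=> UU; split; first exact: fmap_proper_filter.
move=> G GF UG; rewrite eqEsubset; split => // A GA.
have [//|UnA] := in_ultra_setVsetC (f @^-1` A) UU.
have GnA : G (~` A) by exact: UG.
by have /filter_ex[x []] : G (A `&` ~` A) by exact: filterI.
Qed.

(** An ultrafilter makes all bounded functions converge at once, so limits can be
    taken vector by vector and still satisfy every identity that holds before the
    limit. *)
Lemma ultra_bounded_cvg (T : Type) (U : set_system T) (f : T -> R) (M : R) :
  UltraFilter U -> (\forall x \near U, `|f x| <= M) ->
  exists a : R, f @ U --> a.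
Proof.
move=> UU fM; have := @segment_compact R (- M) M; rewrite compact_ultra.
move=> /(_ (f @ U) (ultra_fmap f UU)) [|a [_ fa]]; last by exists a.
by apply: filterS fM => x /=; rewrite in_itv /= ler_norml.
Qed.

End UltraLimit.

(** * Top eigenspace of a form of finite trace *)

Section TopEigenspace.
Variables (R : realType) (V : completeNormedModType R).
Variables (dot : {dot V for idfun}) (normE : induces_norm dot).
(* The axioms are the traits of a nonnegative quadratic form that pass to
   pointwise limits; [q_trace] says that its operator is trace class, hence
   compact, with trace at most [T]. *)
Variables (q : V -> R) (T : R).
Hypothesis q_ge0 : forall v, 0 <= q v.
Hypothesis qZ : forall a v, q (a *: v) = a ^+ 2 * q v.
Hypothesis q_par : forall u v, q (u + v) + q (u - v) = 2 * (q u + q v).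
Hypothesis q_trace :
  forall l, orthonormal_seq dot l -> \sum_(e <- l) q e <= T.

Let unit_values := [set q v | v in [set v | dot v v = 1]].

Lemma form0 : q 0 = 0.
Proof. by rewrite -(scale0r 0) qZ expr0n /= mul0r. Qed.

Lemma q_unit_le v : dot v v = 1 -> q v <= T.
Proof.
move=> v1; have := @q_trace [:: v]; rewrite big_seq1; apply.
by rewrite /orthonormal_seq /= v1 eqxx.
Qed.

Variables (v0 : V) (qv0 : 0 < q v0).

Lemma has_sup_unit_values : has_sup unit_values.
Proof.
split; last by exists T => _ [v v1 <-]; exact: q_unit_le.
have /(ex_unit dot)[a [_ a1]] : v0 != 0.
  by apply: contraTneq qv0 => ->; rewrite form0 ltxx.
by exists (q (a *: v0)), (a *: v0).
Qed.

(** The norm of the operator of [q]. *)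
Definition sup_form : R := sup unit_values.

(** Homogeneity reduces a bound of [q] by a multiple of the square norm to unit
    vectors, on any set of vectors stable by scaling. *)
Lemma le_of_unit (P : V -> Prop) c : (forall a v, a != 0 -> P v -> P (a *: v)) ->
  (forall v, P v -> dot v v = 1 -> q v <= c) ->
  forall v, P v -> q v <= c * dot v v.
Proof.
move=> PZ h v Pv; have [->|vn0] := eqVneq v 0; first by rewrite form0 dot0l mulr0.
have [a [a0 a1]] := ex_unit dot vn0.
have := h _ (PZ a v a0 Pv) a1; rewrite qZ => h1.
have a2 : 0 < a ^+ 2 by rewrite exprn_even_gt0.
rewrite -(ler_pM2l a2); apply: le_trans h1 _.
by move: a1; rewrite dotZl dotZr mulrA -expr2 mulrCA => ->; rewrite mulr1.
Qed.

Lemma q_le_sup v : q v <= sup_form * dot v v.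
Proof.
apply: (@le_of_unit setT) => // u _ u1.
by apply: ub_le_sup; [exact: has_sup_unit_values.2|exists u].
Qed.

Lemma sup_form_gt0 : 0 < sup_form.
Proof.
have := lt_le_trans qv0 (q_le_sup v0); rewrite pmulr_lgt0 // dot_gt0 //.
by apply: contraTneq qv0 => ->; rewrite form0 ltxx.
Qed.

(** A nonnegative form whose zeros are the maximisers of [q]: this turns
    maximality into linear algebra, since the zeros of a nonnegative quadratic form
    are a linear subspace. *)
Definition defect v := sup_form * dot v v - q v.

Lemma defect_ge0 v : 0 <= defect v.
Proof. by rewrite subr_ge0 q_le_sup. Qed.

Lemma defect_le v : defect v <= sup_form * dot v v.
Proof. by rewrite /defect lerBlDr lerDl. Qed.

Lemma defectZ a v : defect (a *: v) = a ^+ 2 * defect v.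
Proof. by rewrite /defect dotZl dotZr qZ; ring. Qed.

Lemma defect_par u v :
  defect (u + v) + defect (u - v) = 2 * (defect u + defect v).
Proof.
by rewrite /defect; have := q_par u v; have := dot_parallelogram dot u v; nra.
Qed.

Lemma defectD u v : defect (u + v) <= 2 * defect u + 2 * defect v.
Proof. by have := defect_par u v; have := defect_ge0 (u - v); lra. Qed.

Lemma defectB u v : defect (u - v) <= 2 * defect u + 2 * defect v.
Proof. by have := defect_par u v; have := defect_ge0 (u + v); lra. Qed.

(** Only boundedly many orthogonal directions can carry a fixed share of a
    finite trace. *)
Lemma size_orthonormal_le c l : 0 < c -> orthonormal_seq dot l ->
  (forall e, e \in l -> c <= q e) -> (size l <= Num.truncn (T / c))%N.
Proof.
move=> c0 ol lc; rewrite truncn_ge_nat; last first.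
  by rewrite divr_ge0 ?(ltW c0)//; have := @q_trace [::]; rewrite big_nil; apply.
rewrite ler_pdivlMr //; apply: le_trans (q_trace ol).
rewrite mulr_natl -[size l]count_predT -iter_addr_0 -big_const_seq.
by rewrite big_seq [leRHS]big_seq; exact: ler_sum.
Qed.

Definition eigenspace := [set v | q v = sup_form * dot v v].

Lemma eigenspaceE v : eigenspace v <-> defect v = 0.
Proof.
rewrite /eigenspace /defect /=; split=> [->|/eqP]; first by rewrite subrr.
by rewrite subr_eq0 => /eqP.
Qed.

Lemma eigenspace0 : eigenspace 0.
Proof. by rewrite /eigenspace /= form0 dot0l mulr0. Qed.

Lemma eigenspaceD u v : eigenspace u -> eigenspace v -> eigenspace (u + v).
Proof.
move=> /eigenspaceE u0 /eigenspaceE w0; apply/eigenspaceE.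
by apply/eqP; rewrite eq_le defect_ge0 (le_trans (defectD _ _)) // u0 w0; lra.
Qed.

Lemma eigenspaceZ a v : eigenspace v -> eigenspace (a *: v).
Proof. by move=> /eigenspaceE v1; apply/eigenspaceE; rewrite defectZ v1 mulr0. Qed.

Lemma eigenspace_sum (I : eqType) (r : seq I) (F : I -> R) (G : I -> V) :
  (forall i, i \in r -> eigenspace (G i)) ->
  eigenspace (\sum_(i <- r) F i *: G i).
Proof.
move=> h; rewrite big_seq; elim/big_rec: _ => [|i x ir Ex]; first exact: eigenspace0.
by apply: eigenspaceD => //; apply/eigenspaceZ/h.
Qed.

(** An orthonormal family in the eigenspace has at most [T / sup_form] members; a
    longest one spans, because the part of a vector orthogonal to the family stays
    in the eigenspace. *)
Lemma finite_dim_eigenspace : finite_dim_subspace eigenspace.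
Proof.
have bound l : orthonormal_seq dot l -> (forall e, e \in l -> eigenspace e) ->
    (size l <= Num.truncn (T / sup_form))%N.
  move=> ol El; apply: size_orthonormal_le => // [|e el]; first exact: sup_form_gt0.
  have /andP[/allP/(_ e el)/eqP e1 _] := ol.
  by have := El e el; rewrite /eigenspace /= e1 mulr1 => ->.
have [l [ol El lmax]] := ex_max_orthonormal bound.
exists (size l), (fun i => l`_i); apply/seteqP; split => v /=; last first.
  move=> [a ->]; apply: eigenspace_sum => i _.
  exact/El/mem_nth.
move=> Ev; exists (fun i => dot v l`_i).
suff {1}-> : v = proj dot l v.
  by rewrite /proj (big_nth 0) big_mkord.
apply/eqP; rewrite -subr_eq0; apply/negPn/negP => /(ex_unit dot)[a [a0 a1]].
apply: (lmax _ _ a1) => [|e el]; last by rewrite dotZl dot_sub_proj // mulr0.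
apply: eigenspaceZ; apply: eigenspaceD => //; rewrite -scaleN1r.
by apply: eigenspaceZ; exact: eigenspace_sum.
Qed.

Lemma dot_lt_norm v d : 0 < d -> (dot v v < d) = (`|v| < Num.sqrt d).
Proof.
move=> d0; rewrite -normE -[X in _ < X]sqr_sqrtr ?(ltW d0)//.
by rewrite ltr_pXn2r // nnegrE.
Qed.

Lemma near_dot (I : Type) (F : set_system I) (f : I -> V) x d : Filter F ->
  f @ F --> x -> 0 < d -> \forall i \near F, dot (f i - x) (f i - x) < d.
Proof.
move=> FF fx d0; have d1 : 0 < Num.sqrt d by rewrite sqrtr_gt0.
near=> i; rewrite dot_lt_norm //; near: i.
exact: (@cvgr_distC_lt _ _ _ F FF f x fx).
Unshelve. all: by end_near. Qed.

(** The quantitative form of compactness that replaces the spectral theorem: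
    away from finitely many directions [q] is at most half its supremum, so there
    the defect controls the norm. *)
Lemma defect_coercive : exists l, orthonormal_seq dot l /\
  forall v, (forall e, e \in l -> dot v e = 0) -> sup_form / 2 * dot v v <= defect v.
Proof.
have t0 : 0 < sup_form / 2 by rewrite divr_gt0 // sup_form_gt0.
have [l [ol El lmax]] := ex_max_orthonormal
  (A := [set v | sup_form / 2 <= q v]) (fun l => size_orthonormal_le (l := l) t0).
exists l; split => // v vl.
suff : q v <= sup_form / 2 * dot v v by rewrite /defect; lra.
apply: (le_of_unit (P := fun v => forall e, e \in l -> dot v e = 0)) vl.
  by move=> a u _ ul e el; rewrite dotZl ul // mulr0.
move=> u ul u1; rewrite leNgt; apply/negP => /ltW qu.
exact: lmax qu u1 ul.
Qed.

Lemma ex_maximizing : exists v : nat -> V, (forall i, dot (v i) (v i) = 1) /\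
  forall i, defect (v i) < i.+1%:R^-1.
Proof.
have h (i : nat) : exists v, dot v v = 1 /\ defect v < i.+1%:R^-1.
  have i0 : 0 < i.+1%:R^-1 :> R by rewrite invr_gt0 ltr0n.
  have [_ [v /= v1 <-] qv] := sup_adherent i0 has_sup_unit_values.
  by exists v; split => //; rewrite /defect v1 mulr1 ltrBlDr addrC -ltrBlDr.
by have [v vP] := choice h; exists v; split => i; have [] := vP i.
Qed.

(** Two near maximisers whose projections to the finitely many bad directions are
    close are close: their difference has small defect, and off those directions a
    small defect forces a small norm. *)
Lemma near_max_dist_le l u v w : orthonormal_seq dot l ->
  (forall v, (forall e, e \in l -> dot v e = 0) -> sup_form / 2 * dot v v <= defect v) ->
  dot (u - v) (u - v) <= 16 / sup_form * (defect u + defect v) +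
    20 * (dot (proj dot l u - w) (proj dot l u - w) +
          dot (proj dot l v - w) (proj dot l v - w)).
Proof.
move=> ol coer; set pu := proj dot l u; set pv := proj dot l v.
pose x := (u - pu) - (v - pv).
have xl e : e \in l -> dot x e = 0.
  by move=> el; rewrite dotDl dotNl !dot_sub_proj // subrr.
have := coer x xl.
have -> : x = (u - v) - (pu - pv) by rewrite /x !opprB addrACA [in RHS]addrACA [- pu + _]addrC.
set y := u - v; set z := pu - pv => cx.
have h1 := defectB y z; have h2 := defectB u v; have h3 := defect_le z.
have h4 := dot_addr_le dot (y - z) z; rewrite subrK in h4.
have h5 : dot z z <= 2 * dot (pu - w) (pu - w) + 2 * dot (pv - w) (pv - w).
  have -> : z = (pu - w) - (pv - w) by rewrite /z opprB addrA subrK.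
  exact: dot_subr_le.
have t0 := sup_form_gt0.
have h6 : dot (y - z) (y - z) <= 2 / sup_form * defect (y - z).
  have -> : dot (y - z) (y - z) = 2 / sup_form * (sup_form / 2 * dot (y - z) (y - z)).
    by field; rewrite gt_eqF.
  by rewrite ler_pM2l // divr_gt0.
have h7 : 2 / sup_form * defect (y - z) <=
    2 / sup_form * (4 * (defect u + defect v) + 2 * (sup_form * dot z z)).
  by rewrite ler_pM2l ?divr_gt0 //; move: h1 h2 h3; rewrite -/y; lra.
have h8 : 2 / sup_form * (4 * (defect u + defect v) + 2 * (sup_form * dot z z)) =
    8 / sup_form * (defect u + defect v) + 4 * dot z z.
  by field; rewrite gt_eqF.
have -> : 16 / sup_form * (defect u + defect v) =
  2 * (8 / sup_form * (defect u + defect v)) by ring.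
by move: h4 h5 h6 h7; rewrite h8; lra.
Qed.

(** Along an ultrafilter the projections of a maximising sequence to the finitely
    many bad directions converge, as their coordinates are bounded, so the sequence
    is Cauchy and its limit is a maximiser. *)
Lemma eigenspace_neq0 : exists2 v, eigenspace v & v != 0.
Proof.
have [l [ol coer]] := defect_coercive.
have [v [v1 dv]] := ex_maximizing.
have [U [UU sU]] := ultraFilterLemma (F := \oo) _.
have dot_cvg e : exists a : R, (fun i => dot (v i) e) @ U --> a.
  apply: (@ultra_bounded_cvg _ _ _ _ (dot e e + 1)) => //; apply: nearW => i.
  have := cauchy_schwarz dot (v i) e; rewrite v1 mul1r => h.
  have e0 := dot_ge0 dot e; rewrite -(@ler_pXn2r _ 2) ?nnegrE ?addr_ge0 //.
  by rewrite real_normK ?num_real //; nra.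
have [a aP] := choice dot_cvg.
pose w := \sum_(e <- l) a e *: e.
have wP : (fun i => proj dot l (v i)) @ U --> w.
  apply: (cvg_big (op := +%R) (P := xpredT)) => [|e _]; first exact: add_continuous.
  exact: cvgZr_tmp.
have nearP d : 0 < d -> \forall i \near U,
    defect (v i) < d /\ dot (proj dot l (v i) - w) (proj dot l (v i) - w) < d.
  move=> d0; apply: filterI; last exact: near_dot wP d0.
  apply: sU; near=> i; apply: lt_trans (dv i) _.
  by near: i; exact: near_infty_natSinv_lt (PosNum d0).
have t0 := sup_form_gt0.
have vC : cauchy (v @ U).
  apply: cauchy_exP => e e0.
  pose d := e ^+ 2 / (32 / sup_form + 40).
  have c0 : 0 < 32 / sup_form + 40 by rewrite addr_gt0 // divr_gt0.
  have d0 : 0 < d by rewrite divr_gt0 // exprn_gt0.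
  have [k [dk wk]] := filter_ex (nearP d d0).
  exists (v k); apply: filterS (nearP d d0) => i [di wi].
  rewrite -ball_normE /= -(gtr0_norm e0) -sqrtr_sqr -dot_lt_norm ?exprn_gt0 //.
  apply: le_lt_trans (near_max_dist_le _ _ w ol coer) _.
  have -> : e ^+ 2 = 16 / sup_form * (d + d) + 20 * (d + d).
    by rewrite /d; field; rewrite !gt_eqF //; nra.
  apply: ltrD; last by lra.
  by rewrite ltr_pM2l ?divr_gt0 //; lra.
have /cvg_ex[x vx] : cvg (v @ U) by exact: cauchy_cvg.
have distP d : 0 < d -> \forall i \near U, dot (v i - x) (v i - x) < d.
  exact: near_dot vx.
exists x.
  apply/eigenspaceE/eqP; rewrite eq_le defect_ge0 andbT.
  apply/ler_addgt0Pl => e e0; rewrite addr0.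
  pose d := e / (2 + 2 * sup_form).
  have c0 : 0 < 2 + 2 * sup_form by lra.
  have d0 : 0 < d by rewrite divr_gt0.
  have [i [[di _] xi]] := filter_ex (filterI (nearP d d0) (distP d d0)).
  have := defectB (v i) (v i - x); rewrite subKr => h.
  have h2 := defect_le (v i - x).
  have h3 : sup_form * dot (v i - x) (v i - x) < sup_form * d by rewrite ltr_pM2l.
  have -> : e = 2 * d + 2 * (sup_form * d) by rewrite /d; field; rewrite gt_eqF.
  by lra.
apply/negP => /eqP x0; have [i] := filter_ex (distP _ ltr01).
by rewrite x0 subr0 v1 ltxx.
Unshelve. all: by end_near. Qed.

End TopEigenspace.

(** * Simple random walk *)

Section Walk.
Variables (R : realType) (G : groupType) (S : {fset G}).
Implicit Types (F : G -> R) (g x : G) (t : nat).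

Definition avg F : R := (\sum_(s <- S) F s) / #|` S|%:R.

Lemma avgD F F' : avg (fun s => F s + F' s) = avg F + avg F'.
Proof. by rewrite /avg big_split mulrDl. Qed.

Lemma avgZ a F : avg (fun s => a * F s) = a * avg F.
Proof. by rewrite /avg -mulr_sumr mulrA. Qed.

Lemma avg_sum (I : Type) (r : seq I) (F : I -> G -> R) :
  avg (fun s => \sum_(i <- r) F i s) = \sum_(i <- r) avg (F i).
Proof. by rewrite /avg exchange_big /= mulr_suml. Qed.

Lemma avg_le F F' : (forall s, s \in S -> F s <= F' s) -> avg F <= avg F'.
Proof.
move=> FF'; rewrite ler_wpM2r ?invr_ge0 ?ler0n //.
by rewrite big_seq [leRHS]big_seq; exact: ler_sum.
Qed.

Lemma avg_inv F : symmetric_set S -> avg (fun s => F (s^-1)%g) = avg F.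
Proof.
move=> symS; rewrite /avg; congr (_ / _).
rewrite -(big_map (fun s : G => (s^-1)%g) xpredT F); apply: perm_big.
apply: uniq_perm; rewrite ?map_inj_uniq ?fset_uniq //; first exact: invg_inj.
move=> s; apply/mapP/idP => [[u uS ->]|sS]; first exact: symS.
by exists (s^-1)%g; rewrite ?invgK //; exact: symS.
Qed.

(** Right multiplication by a generator is a step along an edge for the
    left-invariant word metric. *)
Definition markov F g : R := avg (fun s => F (g * s)%g).

(** The expectation of [F] at time [t] of the walk started at the identity; only
    finite averages occur, so no probability space has to be set up. *)
Definition walk t F : R := iter t markov F 1%g.

(** Conditioning on the last step. *)
Lemma walkSr t F : walk t.+1 F = walk t (markov F).
Proof. by rewrite /walk iterSr. Qed.

Lemma iter_markov t F x : iter t markov F x = walk t (fun g => F (x * g)%g).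
Proof.
suff h y : iter t markov F (x * y)%g = iter t markov (fun g => F (x * g)%g) y.
  by rewrite /walk -h mulg1.
elim: t y => //= t IH y; rewrite /markov; congr avg; apply/funext => s.
by rewrite -mulgA IH.
Qed.

(** Conditioning on the first step; comparing this with the last step is what makes
    the walk reversible and its moments invariant under the group in the limit. *)
Lemma walkSl t F : walk t.+1 F = avg (fun s => walk t (fun g => F (s * g)%g)).
Proof.
rewrite /walk iterS /markov; congr avg; apply/funext => s.
by rewrite mul1g iter_markov.
Qed.

Lemma walk_sum (I : Type) (r : seq I) t (F : I -> G -> R) :
  walk t (fun g => \sum_(i <- r) F i g) = \sum_(i <- r) walk t (F i).
Proof.
elim: t F => // t IH F; rewrite walkSr; under eq_bigr do rewrite walkSr.
by rewrite -IH; congr walk; apply/funext => g; rewrite /markov avg_sum.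
Qed.

Lemma walkD t F F' : walk t (fun g => F g + F' g) = walk t F + walk t F'.
Proof.
elim: t F F' => // t IH F F'; rewrite !walkSr -IH; congr walk.
by apply/funext => g; rewrite /markov avgD.
Qed.

Lemma walkZ t a F : walk t (fun g => a * F g) = a * walk t F.
Proof.
elim: t F => // t IH F; rewrite !walkSr -IH; congr walk.
by apply/funext => g; rewrite /markov avgZ.
Qed.

Lemma walk_avg t (F : G -> G -> R) :
  walk t (fun g => avg (fun s => F s g)) = avg (fun s => walk t (F s)).
Proof.
rewrite /avg -walk_sum mulrC -walkZ; congr walk; apply/funext => g.
by rewrite mulrC.
Qed.

Lemma walk_le t F F' : (forall g, F g <= F' g) -> walk t F <= walk t F'.
Proof.
elim: t F F' => [|t IH] F F' FF'; first exact: FF'.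
by rewrite !walkSr; apply: IH => g; apply: avg_le => s _.
Qed.

(** The law of the walk is symmetric: inversion exchanges the first and the last
    step. *)
Lemma walk_inv t F : symmetric_set S -> walk t (fun g => F (g^-1)%g) = walk t F.
Proof.
move=> symS; elim: t F => [|t IH] F; first by rewrite /walk /= invg1.
rewrite walkSr walkSl -(avg_inv _ symS) -walk_avg -[RHS]IH.
congr walk; apply/funext => g; congr avg; apply/funext => s.
by rewrite invgM.
Qed.

Hypothesis S0 : S != fset0.

Lemma card_gt0 : 0 < #|` S|%:R :> R.
Proof. by rewrite ltr0n cardfs_gt0. Qed.

Lemma avg_cst a : avg (fun=> a) = a.
Proof.
rewrite /avg big_const_seq count_predT iter_addr_0 -[X in X / _]mulr_natr mulfK //.
by rewrite gt_eqF // card_gt0.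
Qed.

Lemma walk_cst t a : walk t (fun=> a) = a.
Proof.
elim: t => // t IH; rewrite walkSr -[RHS]IH; congr walk; apply/funext => g.
exact: avg_cst.
Qed.

End Walk.

(** * Harmonic cocycles along the walk *)

Section HarmonicCocycle.
Variables (R : realType) (G : groupType) (S : {fset G}).
Hypothesis (symS : symmetric_set S) (S0 : S != fset0).
Variables (V : normedModType R) (dot : {dot V for idfun}).
Variables (pi : G -> {linear V -> V}) (piP : orthogonal_rep dot pi).
Variables (b : G -> V) (bP : cocycles pi b).
Hypothesis harm : \sum_(s <- S) b s = 0.

Local Notation avg := (avg S).
Local Notation walk := (walk S).
Local Notation markov := (markov S).

Lemma piV g v : pi (g^-1)%g (pi g v) = v.
Proof. by case: piP => p1 pM _; rewrite -pM mulVg p1. Qed.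

Lemma dot_pi g u v : dot (pi g u) v = dot u (pi (g^-1)%g v).
Proof. by case: piP => _ _ pD; rewrite -(pD g^-1)%g piV. Qed.

Lemma cocycleM g h : b (g * h)%g = b g + pi g (b h).
Proof. exact: bP. Qed.

Lemma cocycle1 : b 1%g = 0.
Proof.
case: piP => p1 _ _; have := cocycleM 1 1; rewrite mulg1 p1 => /eqP.
by rewrite -subr_eq0 opprD addNKr oppr_eq0 => /eqP.
Qed.

Lemma cocycleV g : b (g^-1)%g = - pi (g^-1)%g (b g).
Proof.
by apply/eqP; rewrite -addr_eq0 -cocycleM mulVg cocycle1.
Qed.

Lemma avg_dot w : avg (fun s => dot (b s) w) = 0.
Proof. by rewrite /avg -dot_suml harm dot0l mul0r. Qed.

Lemma dot_cocycleM g s v :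
  dot (b (g * s)%g) v = dot (b g) v + dot (b s) (pi (g^-1)%g v).
Proof. by rewrite cocycleM dotDl dot_pi. Qed.

(** Harmonicity makes [b] a martingale along the walk. *)
Lemma walk_dot t w : walk t (fun g => dot (b g) w) = 0.
Proof.
elim: t => [|t IH]; first by rewrite /walk /= cocycle1 dot0l.
rewrite walkSr -[RHS]IH; congr walk; apply/funext => g.
rewrite /markov; under [X in avg X]funext do rewrite dot_cocycleM.
by rewrite avgD avg_cst // avg_dot addr0.
Qed.

Definition energy g := dot (b g) (b g).
Definition drift := avg energy.

(** The increment is written with [b g^-1], so that its size is a second moment of
    the inverse of the walk, which has the law of the walk. *)
Lemma energyM g s : energy (g * s)%g =
  energy g + energy s - 2 * dot (b (g^-1)%g) (b s).
Proof.
rewrite /energy cocycleV dotNl dot_pi invgK.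
have -> : dot (b s) (b s) = dot (pi g (b s)) (pi g (b s)) by rewrite dot_pi piV.
rewrite cocycleM !(dotDl, dotDr) [dot (pi g (b s)) (b g)]dotC; ring.
Qed.

(** The increments of the martingale [b] are orthogonal and each has mean square
    [drift]. *)
Lemma walk_energy t : walk t energy = t%:R * drift.
Proof.
elim: t => [|t IH]; first by rewrite /walk /= /energy cocycle1 dot0l mul0r.
rewrite walkSr.
have -> : markov energy = fun g => energy g + drift.
  apply/funext => g; rewrite /markov.
  under [X in avg X]funext do rewrite energyM dotC -mulNr.
  by rewrite !avgD avgZ avg_dot mulr0 addr0 avg_cst.
by rewrite walkD walk_cst // IH -natr1 mulrDl mul1r.
Qed.

Definition second_moment t v := walk t (fun g => dot (b g) v ^+ 2).

Lemma second_moment_ge0 t v : 0 <= second_moment t v.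
Proof.
rewrite -(walk_cst S0 t 0); apply: walk_le => g; exact: sqr_ge0.
Qed.

Lemma second_moment_le_succ t v : second_moment t v <= second_moment t.+1 v.
Proof.
rewrite /second_moment walkSr; apply: walk_le => g; rewrite /markov.
under [X in avg X]funext do rewrite dot_cocycleM sqrrD -mulrnAl -addrA.
rewrite avgD avg_cst // lerDl avgD.
under [X in avg X]funext do rewrite -mulr_natl -mulrA.
rewrite !avgZ avg_dot !mulr0 add0r.
by rewrite -(avg_cst S0 0); apply: avg_le => s _; exact: sqr_ge0.
Qed.

Lemma second_moment_mono t t' v : (t <= t')%N ->
  second_moment t v <= second_moment t' v.
Proof.
by move=> /subnK <-; elim: (t' - t)%N => // n IH;
  apply: le_trans IH _; exact: second_moment_le_succ.
Qed.

(** The cross term between the first step and the rest vanishes because [b] is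
    centred. *)
Lemma second_momentSl t v : second_moment t.+1 v =
  avg (fun s => dot (b s) v ^+ 2) +
  avg (fun s => second_moment t (pi (s^-1)%g v)).
Proof.
rewrite /second_moment walkSl -avgD; congr avg; apply/funext => s.
under [X in walk _ X]funext do
  rewrite dot_cocycleM sqrrD -mulr_natl mulrA -addrA.
by rewrite walkD walk_cst // walkD walkZ walk_dot mulr0 add0r.
Qed.

(** Bessel's inequality under the expectation. *)
Lemma second_moment_trace t l : orthonormal_seq dot l ->
  \sum_(e <- l) second_moment t e <= t%:R * drift.
Proof.
move=> ol; rewrite -walk_sum -walk_energy; apply: walk_le => g.
exact: bessel.
Qed.

(** The variance of [energy] at time [t], since its mean is [t * drift]. *)
Definition energy_dev t := walk t (fun g => (energy g - t%:R * drift) ^+ 2).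

Definition step_dev := avg (fun s => (energy s - drift) ^+ 2).

(** The energy minus its mean is a martingale; the square of its increment along
    the generator [s] is, up to bounded terms, the square of the coordinate of
    [b g^-1] along [b s]. *)
Lemma energy_dev_le_succ t : energy_dev t.+1 <= energy_dev t +
  8 * avg (fun s => second_moment t (b s)) + 2 * step_dev.
Proof.
have -> : avg (fun s => second_moment t (b s)) =
    walk t (fun g => avg (fun s => dot (b (g^-1)%g) (b s) ^+ 2)).
  rewrite walk_avg; congr avg; apply/funext => s.
  by rewrite (walk_inv _ (fun g => dot (b g) (b s) ^+ 2)).
rewrite -(walk_cst S0 t (2 * step_dev)) -walkZ -!walkD.
rewrite /energy_dev walkSr; apply: walk_le => g.
set A := energy g - t%:R * drift.
pose D s := energy s - drift - 2 * dot (b (g^-1)%g) (b s).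
have -> : markov (fun g => (energy g - t.+1%:R * drift) ^+ 2) g =
    avg (fun s => A ^+ 2 + (2 * A) * D s + D s ^+ 2).
  rewrite /markov; congr avg; apply/funext => s.
  by rewrite energyM /A /D -natr1; ring.
have -> : avg (fun s => A ^+ 2 + (2 * A) * D s + D s ^+ 2) =
    A ^+ 2 + avg (fun s => D s ^+ 2).
  rewrite !avgD avg_cst // [avg (fun s => 2 * A * D s)]avgZ {1}/D.
  have -> : avg (fun s => energy s - drift - 2 * dot (b (g^-1)%g) (b s)) = 0.
    under [X in avg X]funext do rewrite dotC -[- (2 * _)]mulNr.
    rewrite !avgD avg_cst // [avg (fun s => - 2 * _)]avgZ avg_dot.
    by rewrite -/drift; ring.
  by rewrite mulr0 addr0.
rewrite -addrA lerD2l -!avgZ -avgD; apply: avg_le => s _; rewrite /D.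
set x := energy s - drift; set y := dot _ _.
by have := sqr_ge0 (x + 2 * y); nra.
Qed.

(** If the energy spreads quadratically in time, then some coordinates of [b] must
    have linearly growing second moments: this is how large deviations of the energy
    detect finite-dimensional behaviour. *)
Lemma energy_dev_le t : energy_dev t <=
  t%:R * (8 * avg (fun s => second_moment t (b s)) + 2 * step_dev).
Proof.
suff h n : (n <= t)%N -> energy_dev n <=
  n%:R * (8 * avg (fun s => second_moment t (b s)) + 2 * step_dev) by exact: h.
elim: n => [_|n IH nt].
  rewrite /energy_dev /walk /= /energy cocycle1 dot0l !mul0r subr0 expr0n /=.
  by [].
apply: le_trans (energy_dev_le_succ n) _; rewrite -natr1 mulrDl mul1r addrA.
have h : avg (fun s => second_moment n (b s)) <=
    avg (fun s => second_moment t (b s)).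
  by apply: avg_le => s _; apply: second_moment_mono; exact: ltnW.
have := IH (ltnW nt); lra.
Qed.

End HarmonicCocycle.

(** * Word length *)

Section WordLength.
Variables (G : groupType) (S : {fset G}).
Hypothesis (symS : symmetric_set S) (genS : generating S).
Implicit Types (g h s x y : G).

Lemma word_length_le g n : spelled_in S g n -> (word_length genS g <= n)%N.
Proof.
by rewrite /word_length; case: ex_minnP => m _ mmin gn; apply/mmin/asboolP.
Qed.

Lemma word_length_spelled g : spelled_in S g (word_length genS g).
Proof. by rewrite /word_length; case: ex_minnP => m /asboolP. Qed.

Lemma word_lengthM g h :
  (word_length genS (g * h)%g <= word_length genS g + word_length genS h)%N.
Proof.
have [v [vS sv vg]] := word_length_spelled g.
have [w [wS sw wh]] := word_length_spelled h.
apply: word_length_le; exists (v ++ w); split.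
- by move=> x; rewrite mem_cat => /orP[/vS|/wS].
- by rewrite size_cat sv sw.
- by rewrite big_cat /= vg wh.
Qed.

Lemma word_length1 : word_length genS 1%g = 0.
Proof.
apply/eqP; rewrite -leqn0; apply: word_length_le.
by exists [::]; rewrite big_nil.
Qed.

Lemma word_length_gen s : s \in S -> (word_length genS s <= 1)%N.
Proof.
move=> sS; apply: word_length_le; exists [:: s]; rewrite big_seq1.
by split => // x; rewrite inE => /eqP ->.
Qed.

Lemma word_lengthV g : (word_length genS (g^-1)%g <= word_length genS g)%N.
Proof.
have [w [wS <- <-]] := word_length_spelled g; elim: w wS => [|s w IH] wS.
  by rewrite big_nil invg1 word_length1.
rewrite big_cons invgM; apply: leq_trans (word_lengthM _ _) _.
rewrite /= -addn1 leq_add //; last by apply/word_length_gen/symS/wS/mem_head.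
by apply: IH => x xw; apply: wS; rewrite inE xw orbT.
Qed.

Lemma generating_ind (P : G -> Prop) : P 1%g ->
  (forall s g, s \in S -> P g -> P (s * g)%g) -> forall g, P g.
Proof.
move=> P1 PM g; have [n [w [wS _ <-]]] := genS g; elim: w wS => [|s w IH] wS.
  by rewrite big_nil.
rewrite big_cons; apply: PM; first exact/wS/mem_head.
by apply: IH => x xw; apply: wS; rewrite inE xw orbT.
Qed.

Lemma word_distMr y x s : s \in S ->
  (word_dist genS y (x * s)%g <= (word_dist genS y x).+1)%N.
Proof.
move=> sS; rewrite /word_dist mulgA -addn1.
by apply: leq_trans (word_lengthM _ _) _; rewrite leq_add2l word_length_gen.
Qed.

Variables (n : nat) (F' F : {fset G}).

(** A plateau of height [n] over [F'] with slopes of size one. It is measured from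
    [F'] rather than from the complement of [F], which may be empty. *)
Definition bump x : nat := \max_(y <- F') (n - word_dist genS y x).

Lemma bump_le x : (bump x <= n)%N.
Proof. by apply/bigmax_leqP_seq => y _ _; exact: leq_subr. Qed.

Lemma bump_in x : x \in F' -> bump x = n.
Proof.
move=> xF; apply/eqP; rewrite eqn_leq bump_le /=.
have := @leq_bigmax_seq G (enum_fset F') xpredT (fun y => (n - word_dist genS y x)%N) x xF isT.
by rewrite {1}/word_dist mulVg word_length1 subn0.
Qed.

Lemma bump_succ x s : s \in S -> (bump x <= (bump (x * s)%g).+1)%N.
Proof.
move=> sS; apply/bigmax_leqP_seq => y yF _.
have := @leq_bigmax_seq G (enum_fset F') xpredT
  (fun y => (n - word_dist genS y (x * s)%g)%N) y yF isT.
rewrite -/(bump (x * s)%g) -ltnS; apply: leq_trans.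
by rewrite leq_subLR addnS -addSn -leq_subLR leq_sub2l // word_distMr.
Qed.

Lemma bump_succ' x s : s \in S -> (bump (x * s)%g <= (bump x).+1)%N.
Proof. by move=> sS; have := bump_succ (x * s)%g (symS sS); rewrite mulgK. Qed.

(** The plateau has decreased to zero at distance [n] from [F'], hence outside
    [F]. *)
Lemma bump_out (R : realType) :
  ((n%:R : R)%:E <= set_dist genS R [set` F'] (~` [set` F]))%E ->
  forall x, x \notin F -> bump x = 0%N.
Proof.
move=> dF x xF; apply/eqP; rewrite -leqn0; apply/bigmax_leqP_seq => y yF _.
rewrite leqn0 subn_eq0 -(ler_nat R) -lee_fin; apply: le_trans dF _.
by apply: ereal_inf_lbound; exists y => //; exists x => //=; exact/negP.
Qed.

End WordLength.

(** * The walk killed outside a finite set *)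

Section KilledWalk.
Variables (R : realType) (G : groupType) (S : {fset G}).
Hypothesis (symS : symmetric_set S) (S0 : S != fset0).
Variable F : {fset G}.
Implicit Types (u v : G -> R).

Definition supported u := forall x, x \notin F -> u x = 0.

Definition killed u x : R := if x \in F then markov S u x else 0.

Definition inner u v : R := \sum_(x <- F) u x * v x.

Lemma supported_killed u : supported (killed u).
Proof. by move=> x; rewrite /killed => /negbTE ->. Qed.

Lemma supported_iter k u : supported u -> supported (iter k killed u).
Proof. by case: k => // k _; exact: supported_killed. Qed.

Lemma sum_shift u s : (forall x, x \notin F -> u x = 0) ->
  (forall x, (x * s)%g \notin F -> u x = 0) ->
  \sum_(x <- F) u x = \sum_(x <- F) u (x * s^-1)%g.
Proof.
move=> u1 u2.
rewrite (bigID (fun x => (x * s)%g \in F)) /= [X in _ + X]big1 ?addr0 //.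
rewrite [RHS](bigID (fun x => (x * s^-1)%g \in F)) /= [X in _ + X]big1 ?addr0;
  last by move=> x /u1.
have -> : \sum_(x <- F | (x * s)%g \in F) u x =
   \sum_(x <- [seq (x * s)%g | x <- F] | x \in F) u (x * s^-1)%g.
  by rewrite big_map; apply: eq_bigr => x _; rewrite mulgK.
rewrite -[LHS]big_filter -[RHS]big_filter; apply: perm_big; apply: uniq_perm.
- by rewrite filter_uniq // map_inj_uniq ?fset_uniq //; exact: mulIg.
- by rewrite filter_uniq // fset_uniq.
move=> x; rewrite !mem_filter; case xF : (x \in F) => /=; last by rewrite andbF.
rewrite andbT; apply/mapP/idP => [[y yF ->]|h]; first by rewrite mulgK.
by exists (x * s^-1)%g; rewrite // mulgVK.
Qed.

Lemma inner_killed u v : inner u (killed v) = avg S (fun s => \sum_(x <- F) u x * v (x * s)%g).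
Proof.
rewrite avg_sum /inner big_seq [RHS]big_seq; apply: eq_bigr => x xF.
by rewrite /killed xF /markov avgZ.
Qed.

Lemma innerC u v : inner u v = inner v u.
Proof. by apply: eq_bigr => x _; rewrite mulrC. Qed.

Lemma killed_adjoint u v : supported u -> supported v ->
  inner u (killed v) = inner (killed u) v.
Proof.
move=> su sv; rewrite [RHS]innerC !inner_killed -(avg_inv _ symS); congr avg.
apply/funext => s; rewrite (@sum_shift _ (s^-1)%g).
- by apply: eq_bigr => x _; rewrite invgK mulgK mulrC.
- by move=> x /su ->; rewrite mul0r.
- by move=> x /sv ->; rewrite mulr0.
Qed.

(** The killed walk is self-adjoint because the generating set is symmetric. *)
Lemma inner_iter_double k u : supported u ->
  inner u (iter (k + k) killed u) = inner (iter k killed u) (iter k killed u).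
Proof.
move=> su; suff h j : inner u (iter (j + k) killed u) =
    inner (iter j killed u) (iter k killed u) by exact: h.
elim: j k => // j IH k; rewrite addSn -addnS IH iterS killed_adjoint //;
  exact: supported_iter.
Qed.

Lemma inner_ge0 u : 0 <= inner u u.
Proof. by apply: sumr_ge0 => x _; rewrite -expr2 sqr_ge0. Qed.

Lemma inner_sqr_le u v : 0 < inner u u ->
  inner u v ^+ 2 <= inner u u * inner v v.
Proof.
have sqr_lin a c : inner (fun x => a * v x - c * u x) (fun x => a * v x - c * u x) =
    a ^+ 2 * inner v v - 2 * a * c * inner u v + c ^+ 2 * inner u u.
  rewrite /inner !mulr_sumr -sumrB -big_split /=.
  by apply: eq_bigr => x _; ring.
move=> u0; have := inner_ge0 (fun x => inner u u * v x - inner u v * u x).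
rewrite sqr_lin => h; rewrite -subr_ge0 -(pmulr_rge0 _ u0).
by apply: le_trans h _; rewrite le_eqVlt; apply/orP; left; apply/eqP; ring.
Qed.

(** Cauchy-Schwarz gives [<u, P^k u>^2 <= <u, u> <u, P^(2k) u>], that is Jensen's
    inequality for the spectral measure of [P] at [u] along doubling times; working
    with powers of two avoids the spectral theorem. *)
Lemma return_prob_pow2 u rho m : supported u -> 0 < inner u u -> 0 <= rho ->
  rho * inner u u <= inner u (killed u) ->
  rho ^+ (2 ^ m) * inner u u <= inner u (iter (2 ^ m) killed u).
Proof.
move=> su u0 r0 h; elim: m => [|m IH]; first by rewrite expn0 expr1.
have := inner_sqr_le (iter (2 ^ m) killed u) u0.
rewrite -inner_iter_double // addnn -mul2n -expnS => h2.
rewrite -(ler_pM2l u0); apply: le_trans h2.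
have -> : inner u u * (rho ^+ (2 ^ m.+1) * inner u u) =
    (rho ^+ (2 ^ m) * inner u u) ^+ 2.
  by rewrite expnS mulnC exprM; ring.
rewrite ler_pXn2r // nnegrE ?mulr_ge0 ?exprn_ge0 ?(ltW u0) //.
by apply: le_trans IH; rewrite mulr_ge0 ?exprn_ge0 ?(ltW u0).
Qed.

Lemma iter_killed_le k u v : (forall x, 0 <= u x <= v x) ->
  forall x, 0 <= iter k killed u x <= iter k (markov S) v x.
Proof.
move=> uv; elim: k => // k IH x; rewrite !iterS /killed.
have h0 : 0 <= markov S (iter k killed u) x.
  rewrite -(avg_cst S0 0); apply: avg_le => s _.
  by have /andP[] := IH (x * s)%g.
have h : markov S (iter k killed u) x <= markov S (iter k (markov S) v) x.
  by apply: avg_le => s _; have /andP[] := IH (x * s)%g.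
by case: ifP => _; rewrite ?h0 ?lexx ?h //=; exact: le_trans h.
Qed.

(** Summation by parts: the Dirichlet energy is half the sum of the squared
    slopes plus a boundary term, where [u] is at most one. *)
Lemma dirichlet_le u : supported u ->
  (forall x s, s \in S -> `|u x - u (x * s)%g| <= 1) ->
  inner u u - inner u (killed u) <= #|` F|%:R.
Proof.
move=> su ulip.
have h (s : G) : s \in S -> \sum_(x <- F) u x * u x -
   \sum_(x <- F) u x * u (x * s)%g <= #|` F|%:R.
  move=> sS; pose v x := (x \in F)%:R * u (x * s)%g ^+ 2.
  have vE : \sum_(x <- F) u (x * s)%g ^+ 2 =
      \sum_(x <- F) ((x * s^-1)%g \in F)%:R * u x ^+ 2.
    transitivity (\sum_(x <- F) v x).
      rewrite big_seq [RHS]big_seq; apply: eq_bigr => x xF.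
      by rewrite /v xF mul1r.
    rewrite (@sum_shift _ s).
    - by apply: eq_bigr => x _; rewrite /v mulgVK.
    - by move=> x /negbTE xF; rewrite /v xF mul0r.
    - by move=> x /su xF; rewrite /v xF expr0n /= mulr0.
  have -> : \sum_(x <- F) u x * u x - \sum_(x <- F) u x * u (x * s)%g =
     2^-1 * \sum_(x <- F) (u x - u (x * s)%g) ^+ 2 +
     2^-1 * (\sum_(x <- F) u x ^+ 2 - \sum_(x <- F) u (x * s)%g ^+ 2).
    rewrite -!sumrB !mulr_sumr -big_split /=; apply: eq_bigr => x _.
    by field.
  rewrite vE -sumrB -mulrDr -big_split /= mulr_sumr.
  have -> : #|` F|%:R = \sum_(x <- F) 1 :> R.
    by rewrite big_const_seq count_predT iter_addr_0.
  rewrite big_seq [leRHS]big_seq; apply: ler_sum => x _.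
  have sq (c : R) : `|c| <= 1 -> c ^+ 2 <= 1.
    by move=> c1; rewrite -real_normK ?num_real // expr_le1.
  have h1 := sq _ (ulip x s sS).
  case: (boolP ((x * s^-1)%g \in F)) => xF; first by rewrite mul1r subrr; lra.
  have h2 : u x ^+ 2 <= 1.
    apply: sq; have := ulip (x * s^-1)%g s sS.
    by rewrite mulgVK su // sub0r normrN.
  by rewrite mul0r subr0; lra.
rewrite inner_killed -[inner u u](avg_cst S0) -mulN1r -avgZ -avgD.
rewrite -[leRHS](avg_cst S0); apply: avg_le => s sS.
by rewrite mulN1r; exact: h.
Qed.

End KilledWalk.

(** * Return probabilities from Folner pairs *)

Section FolnerReturn.
Variables (R : realType) (G : groupType) (S : {fset G}).
Hypothesis (symS : symmetric_set S) (genS : generating S) (S0 : S != fset0).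

(** The plateau over [F'] has Rayleigh quotient at least [1 - C / n ^ 2] for the
    walk killed outside [F], so the walk stays in [F] up to time [t] with probability
    about [(1 - C / n ^ 2) ^ t]. Two points of [F] differ by an element where [W] is
    at least one, so the expectation of [W] bounds that probability from above. *)
Lemma folner_return (C : R) (n : nat) (F' F : {fset G}) (W : G -> R) m :
  (0 < n)%N -> F' != fset0 -> (F' `<=` F)%fset ->
  #|` F|%:R <= C * #|` F'|%:R ->
  ((n%:R : R)%:E <= set_dist genS R [set` F'] (~` [set` F]))%E ->
  C <= n%:R ^+ 2 -> (forall g, 0 <= W g) ->
  (forall x y, x \in F -> y \in F -> 1 <= W (x^-1 * y)%g) ->
  (1 - C / n%:R ^+ 2) ^+ (2 ^ m) <= C * walk S (2 ^ m) W.
Proof.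
move=> n0 F'0 F'F cardF distF Cn W0 W1.
have n1 : 0 < n%:R :> R by rewrite ltr0n.
have n2 : 0 < n%:R ^+ 2 :> R by rewrite exprn_gt0.
pose u x : R := (bump genS n F' x)%:R.
have su : supported F u by move=> x xF; rewrite /u (bump_out distF).
have un x : 0 <= u x <= n%:R by rewrite /u ler0n ler_nat bump_le.
have ulip x s : s \in S -> `|u x - u (x * s)%g| <= 1.
  move=> sS; rewrite ler_norml /u.
  have := bump_succ genS n F' x sS; have := bump_succ' symS genS n F' x sS.
  by rewrite -!(ler_nat R) -!natr1; lra.
have normu : n%:R ^+ 2 * #|` F'|%:R <= inner F u u.
  have -> : n%:R ^+ 2 * #|` F'|%:R = \sum_(x <- F') u x * u x.
    rewrite -[#|` F'|]count_predT mulr_natr -iter_addr_0 -big_const_seq.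
    rewrite big_seq [RHS]big_seq; apply: eq_bigr => x xF.
    by rewrite /u bump_in.
  rewrite /inner [leRHS](big_fsetID _ (mem F')) /=.
  have -> : [fset x in F | x \in F']%fset = F'.
    apply/fsetP => x; rewrite !inE /= andbC; case: (boolP (x \in F')) => //=.
    exact/fsubsetP.
  by rewrite lerDl; apply: sumr_ge0 => x _; rewrite -expr2 sqr_ge0.
have F'1 : 0 < #|` F'|%:R :> R by rewrite ltr0n cardfs_gt0.
have C0 : 0 <= C.
  by rewrite -(pmulr_lge0 _ F'1); apply: le_trans cardF; exact: ler0n.
have u0 : 0 < inner F u u by apply: lt_le_trans normu; rewrite mulr_gt0.
have dir : (1 - C / n%:R ^+ 2) * inner F u u <= inner F u (killed S F u).
  have := dirichlet_le S0 su ulip.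
  have h : #|` F|%:R <= C / n%:R ^+ 2 * inner F u u.
    apply: le_trans cardF _; rewrite -mulrA ler_wpM2l //.
    by rewrite mulrC ler_pdivlMr // mulrC.
  by rewrite mulrBl mul1r; lra.
have rho0 : 0 <= 1 - C / n%:R ^+ 2 by rewrite subr_ge0 ler_pdivrMr // mul1r.
have := return_prob_pow2 symS m su u0 rho0 dir.
set t := (2 ^ m)%N.
have up : inner F u (iter t (killed S F) u) <=
    n%:R ^+ 2 * #|` F|%:R * walk S t W.
  have -> : n%:R ^+ 2 * #|` F|%:R * walk S t W =
      \sum_(x <- F) n%:R * (n%:R * walk S t W).
    rewrite big_const_seq count_predT iter_addr_0 -[RHS]mulr_natr; ring.
  rewrite /inner big_seq [leRHS]big_seq; apply: ler_sum => x xF.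
  pose v x := n%:R * (x \in F)%:R : R.
  have uv y : 0 <= u y <= v y.
    have /andP[h1 h2] := un y; rewrite h1 /v.
    by case: (boolP (y \in F)) => [_|/su ->]; rewrite ?mulr1 ?mulr0 ?lexx.
  have /andP[h1 h2] := iter_killed_le S0 F t uv x.
  have /andP[h3 h4] := un x.
  apply: ler_pM => //; apply: le_trans h2 _; rewrite iter_markov -walkZ.
  apply: walk_le => g; rewrite /v ler_wpM2l ?(ltW n1) //.
  case: (boolP ((x * g)%g \in F)) => [xgF|_]; last exact: W0.
  by have := W1 _ _ xF xgF; rewrite mulKg.
move=> low; have := le_trans low up.
have w0 : 0 <= walk S t W by rewrite -(walk_cst S0 t 0); exact: walk_le.
have h : n%:R ^+ 2 * #|` F|%:R * walk S t W <= C * walk S t W * inner F u u.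
  have -> : n%:R ^+ 2 * #|` F|%:R * walk S t W =
    walk S t W * (n%:R ^+ 2 * #|` F|%:R) by ring.
  have -> : C * walk S t W * inner F u u = walk S t W * (C * inner F u u).
    by ring.
  apply: ler_wpM2l => //; apply: le_trans (ler_wpM2l C0 normu).
  by rewrite mulrCA ler_wpM2l // exprn_ge0.
by move=> /le_trans/(_ h); rewrite ler_pM2r.
Qed.

End FolnerReturn.

(** * Harmonic representatives of reduced cohomology classes *)

Section HarmonicRepresentative.
Variables (R : realType) (G : groupType) (S : {fset G}).
Hypothesis (symS : symmetric_set S) (genS : generating S).
Variables (V : completeNormedModType R) (dot : {dot V for idfun}).
Hypothesis (normE : induces_norm dot).
Variables (pi : G -> {linear V -> V}) (piP : orthogonal_rep dot pi).
Variables (b : G -> V) (bP : cocycles pi b).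

(** Written as a function of [g] so that [cohom v] runs over the cohomology class
    of [b]. *)
Definition cobound (v : V) g : V := pi g v - v.

Definition cohom v g := b g + cobound v g.

Lemma coboundD u v g : cobound (u + v) g = cobound u g + cobound v g.
Proof. by rewrite /cobound linearD opprD addrACA. Qed.

Lemma coboundZ a v g : cobound (a *: v) g = a *: cobound v g.
Proof. by rewrite /cobound linearZ scalerBr. Qed.

Lemma coboundN v g : cobound (- v) g = - cobound v g.
Proof. by rewrite -scaleN1r coboundZ scaleN1r. Qed.

Lemma cohomD v w g : cohom (v + w) g = cohom v g + cobound w g.
Proof. by rewrite /cohom coboundD addrA. Qed.

Lemma cohom_cocycle v : cocycles pi (cohom v).
Proof.
move=> g h; rewrite /cohom /cobound bP; case: piP => _ pM _.
rewrite pM linearD linearB /= [RHS]addrACA; congr (_ + _).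
by rewrite addrC addrA subrK.
Qed.

Definition total_energy (c : G -> V) : R := \sum_(s <- S) dot (c s) (c s).

Lemma total_energy_ge0 c : 0 <= total_energy c.
Proof. by apply: sumr_ge0 => s _; exact: dot_ge0. Qed.

Lemma le_total_energy c s : s \in S -> dot (c s) (c s) <= total_energy c.
Proof.
move=> sS; rewrite /total_energy (big_fsetD1 s) //= lerDl.
by apply: sumr_ge0 => x _; exact: dot_ge0.
Qed.

Definition min_energy : R := inf [set total_energy (cohom v) | v in setT].

Lemma has_inf_energy : has_inf [set total_energy (cohom v) | v in setT].
Proof.
split; first by exists (total_energy (cohom 0)), 0.
by exists 0 => _ [v _ <-]; exact: total_energy_ge0.
Qed.

Lemma min_energy_le v : min_energy <= total_energy (cohom v).
Proof. by apply: ge_inf; [exact: has_inf_energy.2|exists v]. Qed.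

Lemma ex_minimizing : exists v : nat -> V,
  forall i, total_energy (cohom (v i)) < min_energy + i.+1%:R^-1.
Proof.
have h (i : nat) : exists v, total_energy (cohom v) < min_energy + i.+1%:R^-1.
  have i0 : 0 < i.+1%:R^-1 :> R by rewrite invr_gt0 ltr0n.
  by have [_ [v _ <-] ve] := inf_adherent i0 has_inf_energy; exists v.
by have [v vP] := choice h; exists v.
Qed.

(** The energy is the square norm of a Hilbert space restricted to an affine
    subspace, so the parallelogram law at the midpoint makes near minimisers
    close. *)
Lemma near_min_dist_le u v :
  total_energy (fun s => cohom u s - cohom v s) <=
  2 * (total_energy (cohom u) - min_energy) +
  2 * (total_energy (cohom v) - min_energy).
Proof.
pose m := 2^-1 *: (u + v).
have mE s : 2%:R *: cohom m s = cohom u s + cohom v s.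
  rewrite /cohom /m coboundZ coboundD scalerDr scalerA mulfV ?pnatr_eq0 //.
  by rewrite scale1r scaler_nat mulr2n addrACA.
have := min_energy_le m => hm.
suff -> : total_energy (fun s => cohom u s - cohom v s) =
    2 * total_energy (cohom u) + 2 * total_energy (cohom v) -
    4 * total_energy (cohom m) by lra.
rewrite /total_energy !mulr_sumr -big_split -sumrB /=; apply: eq_bigr => s _.
have := dot_parallelogram dot (cohom u s) (cohom v s).
by rewrite -mE dotZl dotZr; lra.
Qed.

(** The gradient of the energy at [cohom v] is minus four times the sum of
    [cohom v] over the generators. Moving [v] by that sum divided by [2 * #|S|]
    decreases the energy by at least its square norm divided by [#|S|], which cannot
    exceed the distance to the infimum. *)
Lemma near_min_divergence_le v :
  dot (\sum_(s <- S) cohom v s) (\sum_(s <- S) cohom v s) <=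
  #|` S|%:R * (total_energy (cohom v) - min_energy).
Proof.
set h := \sum_(s <- S) cohom v s; have [S0|S0] := eqVneq S fset0.
  by rewrite /h S0 big_nil dot0l cardfs0 mul0r.
have n0 : 0 < #|` S|%:R :> R by rewrite ltr0n cardfs_gt0.
set n := #|` S|%:R in n0 *.
have [p1 pM pD] := piP.
have var t : total_energy (cohom (v + t *: h)) =
    total_energy (cohom v) + 2 * t * \sum_(s <- S) dot (cohom v s) (cobound h s)
    + t ^+ 2 * total_energy (cobound h).
  rewrite /total_energy !mulr_sumr -!big_split /=; apply: eq_bigr => s _.
  rewrite cohomD coboundZ.
  move: (cohom v s) (cobound h s) => x y.
  by rewrite !(dotDl, dotDr, dotZl, dotZr) [dot y x]dotC; ring.
have cross : \sum_(s <- S) dot (cohom v s) (cobound h s) = - (2 * dot h h).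
  have -> : \sum_(s <- S) dot (cohom v s) (cobound h s) =
     - (\sum_(s <- S) dot (cohom v (s^-1)%g) h + \sum_(s <- S) dot (cohom v s) h).
    rewrite -big_split -sumrN /=; apply: eq_bigr => s _.
    rewrite /cobound dotDr dotNr opprD; congr (_ - _).
    rewrite (cocycleV piP (cohom_cocycle v)) dotNl opprK.
    by rewrite (dot_pi piP) invgK.
  have -> : \sum_(s <- S) dot (cohom v (s^-1)%g) h = \sum_(s <- S) dot (cohom v s) h.
    have := avg_inv (fun s => dot (cohom v s) h) symS.
    by rewrite /avg => /(mulIf _) -> //; rewrite invr_eq0 gt_eqF.
  by rewrite -dot_suml -/h; ring.
have cob : total_energy (cobound h) <= 4 * n * dot h h.
  have -> : 4 * n * dot h h = \sum_(s <- S) (4 * dot h h).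
    by rewrite big_const_seq count_predT iter_addr_0 -[RHS]mulr_natr -/n; ring.
  apply: ler_sum => s _; have := dot_subr_le dot (pi s h) h.
  by rewrite pD /cobound; lra.
have := min_energy_le (v + (2 * n)^-1 *: h); rewrite var cross => hm.
have h1 : (2 * n)^-1 ^+ 2 * total_energy (cobound h) <=
   (2 * n)^-1 ^+ 2 * (4 * n * dot h h) by rewrite ler_wpM2l // sqr_ge0.
have h2 : (2 * n)^-1 ^+ 2 * (4 * n * dot h h) = dot h h / n.
  by field; rewrite gt_eqF.
have h3 : 2 * (2 * n)^-1 * - (2 * dot h h) = - (2 * (dot h h / n)).
  by field; rewrite gt_eqF.
rewrite mulrC -ler_pdivrMr //; move: h1 hm; rewrite h2 h3; lra.
Qed.

Lemma cvg_pi (I : Type) (F : set_system I) (f : I -> V) x g : Filter F ->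
  f @ F --> x -> (fun i => pi g (f i)) @ F --> pi g x.
Proof.
move=> FF fx; apply/cvgrPdist_lt => e e0; near=> i.
have -> : `|pi g x - pi g (f i)| = `|x - f i|.
  apply/eqP; rewrite -linearB -(@eqrXn2 _ 2) // !normE.
  by case: piP => _ _ ->.
by near: i; move/cvgrPdist_lt : fx; exact.
Unshelve. all: by end_near. Qed.

(** The limit of a minimising sequence in the cohomology class. If its energy
    vanished, the sequence would tend to zero pointwise and [b] would be a limit of
    coboundaries. *)
Lemma ex_harmonic : ~ closure (coboundaries pi) b ->
  exists c, [/\ cocycles pi c, \sum_(s <- S) c s = 0 & 0 < total_energy c].
Proof.
move=> bn; have [v vE] := ex_minimizing.
have [p1 pM pD] := piP.
have near_inv d : 0 < d -> \forall i \near \oo, i.+1%:R^-1 < d :> R.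
  by move=> d0; exact: near_infty_natSinv_lt (PosNum d0).
have cvg_gen s : s \in S -> cvg ((fun i => cohom (v i) s) @ \oo).
  move=> sS; apply: cauchy_cvg; apply: cauchy_exP => e e0.
  have d0 : 0 < e ^+ 2 / 4 by rewrite divr_gt0 // exprn_gt0.
  have [k dk] := filter_ex (near_inv _ d0).
  exists (cohom (v k) s); apply: filterS (near_inv _ d0) => i di.
  rewrite -ball_normE /= -(gtr0_norm e0) -sqrtr_sqr -(dot_lt_norm normE) ?exprn_gt0 //.
  have := le_total_energy (fun s => cohom (v k) s - cohom (v i) s) sS.
  move=> /le_lt_trans; apply; apply: le_lt_trans (near_min_dist_le _ _) _.
  have := vE k; have := vE i; move: dk di => /=.
  by move: (k.+1%:R^-1) (i.+1%:R^-1) => x y; lra.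
have cvg_all g : cvg ((fun i => cohom (v i) g) @ \oo).
  move: g; apply: (generating_ind genS).
    under eq_fun do rewrite (cocycle1 piP (cohom_cocycle _)).
    exact: is_cvg_cst.
  move=> s g sS gC.
  under eq_fun do rewrite cohom_cocycle.
  apply: is_cvgD; first exact: cvg_gen.
  have /cvg_ex[x gx] := gC; apply/cvg_ex; exists (pi s x).
  exact: cvg_pi.
pose c g := lim ((fun i => cohom (v i) g) @ \oo).
have cP g : (fun i => cohom (v i) g) @ \oo --> c g by exact: cvg_all.
have cC : cocycles pi c.
  move=> g h; apply: (cvg_unique (@norm_hausdorff _ V) (cP (g * h)%g)).
  have -> : (fun i => cohom (v i) (g * h)%g) =
      (fun i => cohom (v i) g + pi g (cohom (v i) h)).
    by apply/funext => i; rewrite cohom_cocycle.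
  by apply: cvgD; [exact: cP|exact: cvg_pi].
exists c; split => //.
- pose h i := \sum_(s <- S) cohom (v i) s.
  have hc : h @ \oo --> \sum_(s <- S) c s.
    apply: (cvg_big (op := +%R) (P := xpredT)) => [|s _]; first exact: add_continuous.
    exact: cP.
  set x := \sum_(s <- S) c s in hc *.
  apply/eqP; rewrite -(dot_eq0 dot) eq_le dot_ge0 andbT.
  apply/ler_addgt0Pl => e e0; rewrite addr0.
  have n0 : 0 < #|` S|%:R + 1 :> R by rewrite ltr_wpDl.
  have d0 : 0 < e / (2 * (#|` S|%:R + 1)) by rewrite divr_gt0 // mulr_gt0.
  have [i [di xi]] := filter_ex (filterI (near_inv _ d0) (near_dot normE _ hc d0)).
  have := dot_subr_le dot (h i) (h i - x); rewrite subKr => h1.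
  have h2 := near_min_divergence_le (v i).
  have h3 : total_energy (cohom (v i)) - min_energy <= e / (2 * (#|` S|%:R + 1)).
    by have := vE i; move: di => /=; move: (i.+1%:R^-1) => y; lra.
  have h4 := ler_wpM2l (ler0n R #|` S|) h3.
  have h5 : e = 2 * (#|` S|%:R * (e / (2 * (#|` S|%:R + 1)))) +
      2 * (e / (2 * (#|` S|%:R + 1))) by field; rewrite gt_eqF.
  rewrite -/(h i) in h2; lra.
rewrite lt_neqAle total_energy_ge0 andbT eq_sym; apply/negP => /eqP c0.
have cgen s : s \in S -> c s = 0.
  move=> sS; apply/eqP; rewrite -(dot_eq0 dot) eq_le dot_ge0 andbT -c0.
  exact: le_total_energy.
have c_eq0 g : c g = 0.
  move: g; apply: (generating_ind genS); first exact: (cocycle1 piP cC).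
  by move=> s g sS gC; rewrite cC cgen // gC linear0 addr0.
apply: bn => B bB.
have /(_ B bB) [i _ iB] : {ptws, (fun i => cobound (- v i)) @ \oo --> b}.
  apply/cvg_sup => g; apply/cvg_image.
    by rewrite eqEsubset; split=> x // _; exists (fun=> x).
  have bg : (fun i => cobound (- v i) g) @ \oo --> b g.
    have -> : (fun i => cobound (- v i) g) = (fun i => b g - cohom (v i) g).
      by apply/funext => i; rewrite coboundN /cohom; move: (cobound _ _) => y; rewrite opprD addrA subrr add0r.
    rewrite -[X in _ --> X]subr0 -(c_eq0 g).
    by apply: cvgB; [exact: cvg_cst|exact: cP].
  move=> W /bg Wb; exists ((fun f : G -> V => f g) @^-1` W) => //.
  by rewrite eqEsubset; split => [x [? + <-]//|x Wx]; exists (fun=> x).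
exists (cobound (- v i)); split; last by apply: iB => /=.
by exists (- v i).
Qed.

End HarmonicRepresentative.

(** * The limit quadratic form *)

Section LimitForm.
Variables (R : realType) (G : groupType) (S : {fset G}).
Hypothesis (symS : symmetric_set S) (genS : generating S) (S0 : S != fset0).
Variables (V : completeNormedModType R) (dot : {dot V for idfun}).
Hypothesis (normE : induces_norm dot).
Variables (pi : G -> {linear V -> V}) (piP : orthogonal_rep dot pi).
Variables (b : G -> V) (bP : cocycles pi b).
Hypothesis harm : \sum_(s <- S) b s = 0.

Local Notation avg := (avg S).
Local Notation moment := (second_moment S dot b).
Local Notation sigma := (drift S dot b).

Lemma momentZ t a v : moment t (a *: v) = a ^+ 2 * moment t v.
Proof.
rewrite /second_moment -walkZ; congr walk; apply/funext => g.
by rewrite dotZr exprMn.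
Qed.

Lemma moment_par t u v :
  moment t (u + v) + moment t (u - v) = 2 * (moment t u + moment t v).
Proof.
rewrite /second_moment -!walkD -walkZ; congr walk; apply/funext => g.
by rewrite !dotDr dotNr; ring.
Qed.

Lemma moment_le t v : moment t v <= t%:R * (sigma * dot v v).
Proof.
rewrite mulrA -(walk_energy S0 piP bP harm) mulrC -walkZ.
by apply: walk_le => g; rewrite mulrC; exact: cauchy_schwarz.
Qed.

Variables (kappa : R) (k0 : 0 < kappa) (t : nat -> nat).
Hypothesis (t_ge : forall i, (i < t i)%N).
Hypothesis (growth : forall i,
  kappa * (t i)%:R <= avg (fun s => moment (t i) (b s))).

Let ti0 i : 0 < (t i)%:R :> R.
Proof. by rewrite ltr0n; apply: leq_ltn_trans (t_ge i). Qed.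

Variables (U : set_system nat) (UU : UltraFilter U).
Hypothesis sU : \oo `<=` U.
Variable q : V -> R.
Hypothesis qP : forall v, (fun i => moment (t i) v / (t i)%:R) @ U --> q v.

Lemma limit_uniq (f : nat -> R) (x y : R) : f @ U --> x -> f @ U --> y -> x = y.
Proof. by move=> fx fy; apply: cvg_unique fx fy; exact: norm_hausdorff. Qed.

Lemma limit_le (f g : nat -> R) (x y : R) : f @ U --> x -> g @ U --> y ->
  (forall i, f i <= g i) -> x <= y.
Proof. by move=> fx gy fg; apply: ler_cvg_to fx gy _; exact: nearW. Qed.

Lemma limit_cst (c : R) : (fun=> c) @ U --> c.
Proof. exact: cvg_cst. Qed.

Lemma limit_form_ge0 v : 0 <= q v.
Proof.
apply: (limit_le (@limit_cst 0) (@qP v)) => i.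
by rewrite divr_ge0 ?(ltW (ti0 i)) ?second_moment_ge0.
Qed.

Lemma limit_formZ a v : q (a *: v) = a ^+ 2 * q v.
Proof.
apply: limit_uniq (@qP _) _; under eq_fun do rewrite momentZ -mulrA.
by apply: cvgM; [exact: cvg_cst|exact: qP].
Qed.

Lemma limit_form_par u v : q (u + v) + q (u - v) = 2 * (q u + q v).
Proof.
pose f w i := moment (t i) w / (t i)%:R.
have h2 : (fun i => 2 * (f u i + f v i)) @ U --> 2 * (q u + q v).
  by apply: cvgM; [exact: cvg_cst|apply: cvgD; exact: qP].
apply: limit_uniq h2.
have -> : (fun i => 2 * (f u i + f v i)) = (fun i => f (u + v) i + f (u - v) i).
  by apply/funext => i; rewrite /f -!mulrDl moment_par mulrA.
by apply: cvgD; exact: qP.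
Qed.

Lemma cvg_sum_moment (I : Type) (r : seq I) (v : I -> V) :
  (fun i => \sum_(j <- r) moment (t i) (v j) / (t i)%:R) @ U -->
  \sum_(j <- r) q (v j).
Proof.
apply: (cvg_big (op := +%R) (P := xpredT)) => [|j _]; first exact: add_continuous.
exact: qP.
Qed.

Lemma cvg_avg_moment (v : G -> V) :
  (fun i => avg (fun s => moment (t i) (v s)) / (t i)%:R) @ U -->
  avg (fun s => q (v s)).
Proof.
have -> : (fun i => avg (fun s => moment (t i) (v s)) / (t i)%:R) =
    (fun i => avg (fun s => moment (t i) (v s) / (t i)%:R)).
  apply/funext => i; rewrite mulrC -avgZ; congr avg; apply/funext => s.
  by rewrite mulrC.
by apply: cvgM; [exact: cvg_sum_moment|exact: cvg_cst].
Qed.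

Lemma limit_form_trace l : orthonormal_seq dot l -> \sum_(e <- l) q e <= sigma.
Proof.
move=> ol; apply: (limit_le (@cvg_sum_moment _ l id) (@limit_cst sigma)) => i; rewrite -mulr_suml ler_pdivrMr // mulrC.
exact: (second_moment_trace S0 piP bP harm).
Qed.

(** Absorbs the contribution of one step when the moments are divided by time. *)
Lemma cvg_inv_t a : (fun i => a / (t i)%:R) @ U --> (0 : R).
Proof.
rewrite -(mulr0 a); apply: cvgM; first exact: cvg_cst.
apply/cvgrPdist_lt => e e0; apply: sU; near=> i.
rewrite sub0r normrN gtr0_norm ?invr_gt0 //.
have : i.+1%:R^-1 < e by near: i; exact: near_infty_natSinv_lt (PosNum e0).
apply: le_lt_trans; rewrite lef_pV2 ?posrE //; first by rewrite ler_nat.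
Unshelve. all: by end_near. Qed.

(** Moving the walk by its first step translates the moments by a generator and
    adds a bounded term, while adding a last step does not decrease them. *)
Lemma limit_form_mean_le v : q v <= avg (fun s => q (pi (s^-1)%g v)).
Proof.
pose a := avg (fun s => dot (b s) v ^+ 2).
have h : (fun i => a / (t i)%:R +
    avg (fun s => moment (t i) (pi (s^-1)%g v)) / (t i)%:R) @ U -->
    0 + avg (fun s => q (pi (s^-1)%g v)).
  by apply: cvgD; [exact: cvg_inv_t|exact: cvg_avg_moment].
rewrite -[leRHS]add0r; apply: (limit_le (@qP v) h) => i.
rewrite -mulrDl ler_pM2r ?invr_gt0 // -(second_momentSl S0 piP bP harm).
exact: (second_moment_le_succ S0 piP bP harm).
Qed.

(** The growth hypothesis survives the limit. *)
Lemma limit_form_neq0 : exists v, 0 < q v.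
Proof.
have h : kappa <= avg (fun s => q (b s)).
  apply: (limit_le (@limit_cst kappa) (@cvg_avg_moment b)) => i.
  by rewrite ler_pdivlMr.
apply: contrapT => /forallNP qn.
have : avg (fun s => q (b s)) <= avg (fun=> 0).
  by apply: avg_le => s _; rewrite leNgt; apply/negP; exact: qn.
by rewrite avg_cst // leNgt (lt_le_trans k0 h).
Qed.

(** The top eigenspace of the limit form is a subrepresentation: if [q] is maximal
    at [v], then the mean of [q] over the translates of [v] is at least the maximum,
    so [q] is maximal at each translate. *)
Lemma finite_dim_of_limit_form : has_finite_dim_subrep pi.
Proof.
have [v0 qv0] := limit_form_neq0.
exists (eigenspace dot q); split.
- exact: (finite_dim_eigenspace limit_formZ limit_form_par limit_form_trace qv0).
- apply: (generating_ind genS) => [v Ev|s g sS IH v Ev].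
    by case: piP => -> _ _.
  have [_ pM pD] := piP; rewrite pM; move: (IH v Ev).
  move: (pi g v) => {v Ev} v Ev.
  (* Nonnegative defects with a nonpositive mean all vanish. *)
  pose d s := sup_form dot q * dot v v - q (pi (s^-1)%g v).
  have d0 s' : 0 <= d s'.
    rewrite subr_ge0 -(pD (s'^-1)%g v v).
    exact: (q_le_sup limit_formZ limit_form_trace qv0).
  have : avg d <= 0.
    rewrite /d avgD.
    have -> : avg (fun s => - q (pi (s^-1)%g v)) = - avg (fun s => q (pi (s^-1)%g v)).
      by rewrite -[RHS]mulN1r -avgZ; congr avg; apply/funext => x; rewrite mulN1r.
    rewrite avg_cst // subr_le0 -[leLHS]Ev; exact: limit_form_mean_le.
  rewrite /avg pmulr_lle0 ?invr_gt0 ?card_gt0 // => dsum.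
  have : d (s^-1)%g <= 0.
    apply: le_trans dsum; rewrite (big_fsetD1 (s^-1)%g) /= ?lerDl ?sumr_ge0 //.
    exact: symS.
  rewrite /d invgK subr_le0 => h; rewrite /eigenspace /= pD.
  apply/eqP; rewrite eq_le h andbT -(pD s v v).
  exact: (q_le_sup limit_formZ limit_form_trace qv0).
have [v Ev v0'] := eigenspace_neq0 normE limit_form_ge0 limit_formZ limit_form_par limit_form_trace qv0.
by move=> E0; move: Ev; rewrite E0 /= => /eqP; rewrite (negbTE v0').
Qed.

End LimitForm.

(** * Linear growth of the second moments *)

Section Growth.
Variables (R : realType) (G : groupType) (S : {fset G}).
Hypothesis (symS : symmetric_set S) (genS : generating S) (S0 : S != fset0).
Variables (V : completeNormedModType R) (dot : {dot V for idfun}).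
Hypothesis (normE : induces_norm dot).
Variables (pi : G -> {linear V -> V}) (piP : orthogonal_rep dot pi).
Variables (b : G -> V) (bP : cocycles pi b).
Hypothesis harm : \sum_(s <- S) b s = 0.
Hypothesis b0 : 0 < total_energy S dot b.

Local Notation avg := (avg S).
Local Notation moment := (second_moment S dot b).
Local Notation sigma := (drift S dot b).
Local Notation total := (total_energy S dot b).
Local Notation dev := (energy_dev S dot b).

Lemma drift_gt0 : 0 < sigma.
Proof. by rewrite /drift /avg divr_gt0 // card_gt0. Qed.

Lemma norm_cocycle_le g : `|b g| <= Num.sqrt total * (word_length genS g)%:R.
Proof.
have [w [wS <- <-]] := word_length_spelled genS g.
elim: w wS => [|s w IH] wS.
  by rewrite big_nil (cocycle1 piP bP) normr0 mulr0.
rewrite big_cons bP -natr1 mulrDr mulr1 addrC.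
apply: le_trans (ler_normD _ _) _; apply: lerD.
  have -> : `|pi s (b (\prod_(j <- w) j)%g)| = `|b (\prod_(j <- w) j)%g|.
    by apply/eqP; rewrite -(@eqrXn2 _ 2) // !normE; case: piP => _ _ ->.
  by apply: IH => x xw; apply: wS; rewrite inE xw orbT.
rewrite -(@ler_pXn2r _ 2) ?nnegrE ?sqrtr_ge0 // normE sqr_sqrtr ?(ltW b0) //.
by apply: le_total_energy; apply/wS/mem_head.
Qed.

Lemma energy_le g : energy dot b g <= total * (word_length genS g)%:R ^+ 2.
Proof.
rewrite /energy -normE -[X in X * _]sqr_sqrtr ?(ltW b0) // -exprMn.
by rewrite ler_pXn2r ?nnegrE ?mulr_ge0 ?sqrtr_ge0 // norm_cocycle_le.
Qed.

(** The return estimate holds at powers of two, which meet every dyadic range. *)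
Lemma ex_pow2 (y : R) : 1 <= y -> exists m, y <= (2 ^ m)%:R <= 2 * y.
Proof.
move=> y1; have exm : exists m, y <= (2 ^ m)%:R.
  exists (Num.truncn y).+1; apply/ltW/(lt_le_trans (truncnS_gt y)).
  by rewrite ler_nat ltnW // ltn_expl.
case: (ex_minnP exm) => -[|m] ym mmin; exists m.+1 || exists 0%N; rewrite ?ym /=.
  by rewrite expn0; lra.
rewrite expnS natrM ler_pM2l // leNgt; apply/negP => /ltW/mmin.
by rewrite ltnn.
Qed.

Lemma one_sub_ge_exp (x : R) : 0 <= x <= 2^-1 -> expR (- (2 * x)) <= 1 - x.
Proof.
move=> /andP[x0 x1]; rewrite expRN.
have h := expR_ge1Dx (2 * x).
have h1 : 0 < 1 + 2 * x by lra.
apply: (@le_trans _ _ (1 + 2 * x)^-1).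
  by rewrite lef_pV2 ?posrE // (lt_le_trans h1).
rewrite -[leLHS]mul1r ler_pdivrMr //; nra.
Qed.

(** Two points of [F] differ by an element of length at most [2 * C * n], where the
    energy is at most [4 * total * C ^ 2 * n ^ 2]. The condition on [K] makes this
    less than half of the mean energy at time [2 ^ m], while the time is still of
    order [n ^ 2], so that returning to such elements keeps a probability bounded
    below. *)
Lemma energy_dev_ge (C : R) (n : nat) (F' F : {fset G}) (m : nat) (K : R) :
  (0 < n)%N -> F' != fset0 -> (F' `<=` F)%fset ->
  #|` F|%:R <= C * #|` F'|%:R ->
  ((n%:R : R)%:E <= set_dist genS R [set` F'] (~` [set` F]))%E ->
  [set` F] `<=` word_ball genS 1%g (C * n%:R) ->
  2 * C <= n%:R ^+ 2 -> 8 * total * C ^+ 2 <= K * sigma -> 1 <= K ->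
  K * n%:R ^+ 2 <= (2 ^ m)%:R <= 2 * (K * n%:R ^+ 2) ->
  sigma ^+ 2 * expR (- (4 * C * K)) / (4 * C) * (2 ^ m)%:R ^+ 2 <= dev (2 ^ m).
Proof.
move=> n0 F'0 F'F cF dF ballF nC KC K1 /andP[t1 t2].
set t := (2 ^ m)%N in t1 t2 *.
have n1 : 0 < n%:R :> R by rewrite ltr0n.
have n2 : 0 < n%:R ^+ 2 :> R by rewrite exprn_gt0.
have s0 := drift_gt0.
have F'1 : 0 < #|` F'|%:R :> R by rewrite ltr0n cardfs_gt0.
have C0 : 0 < C.
  rewrite -(pmulr_lgt0 _ F'1); apply: lt_le_trans cF.
  by apply: lt_le_trans F'1 _; rewrite ler_nat fsubset_leq_card.
have t0 : 0 < t%:R :> R.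
  by apply: lt_le_trans t1; rewrite mulr_gt0 //; lra.
have ts0 : 0 < t%:R * sigma by rewrite mulr_gt0.
(* Normalised to be at least one where the energy misses its mean by half. *)
pose W g := 4 / (t%:R * sigma) ^+ 2 * (energy dot b g - t%:R * sigma) ^+ 2.
have W0 g : 0 <= W g by rewrite mulr_ge0 ?sqr_ge0 // divr_ge0 ?sqr_ge0.
have W1 x y : x \in F -> y \in F -> 1 <= W (x^-1 * y)%g.
  have len z : z \in F -> (word_length genS z)%:R <= C * n%:R.
    by move=> zF; have := ballF z zF; rewrite /word_ball /= /word_dist invg1 mul1g.
  move=> xF yF; set g := (x^-1 * y)%g.
  have lg : (word_length genS g)%:R <= 2 * (C * n%:R).
    have h : ((word_length genS g)%:R : R) <=
        (word_length genS x)%:R + (word_length genS y)%:R.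
      rewrite -natrD ler_nat; apply: leq_trans (word_lengthM _ _ _) _.
      by rewrite leq_add2r word_lengthV.
    by have := len x xF; have := len y yF; lra.
  have eg : energy dot b g <= t%:R * sigma / 2.
    apply: le_trans (energy_le g) _.
    apply: (@le_trans _ _ (total * (2 * (C * n%:R)) ^+ 2)).
      rewrite ler_pM2l // ler_pXn2r ?nnegrE //.
      by rewrite mulr_ge0 // mulr_ge0 // ltW.
    have h1 : 8 * total * C ^+ 2 * n%:R ^+ 2 <= K * sigma * n%:R ^+ 2.
      by rewrite ler_pM2r.
    have h2 : K * n%:R ^+ 2 * sigma <= t%:R * sigma by rewrite ler_pM2r.
    have -> : total * (2 * (C * n%:R)) ^+ 2 = 8 * total * C ^+ 2 * n%:R ^+ 2 / 2.
      by field.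
    have h3 : K * sigma * n%:R ^+ 2 = K * n%:R ^+ 2 * sigma by ring.
    by rewrite ler_pM2r //; rewrite h3 in h1; exact: le_trans h1 h2.
  have eg2 : (t%:R * sigma / 2) ^+ 2 <= (energy dot b g - t%:R * sigma) ^+ 2.
    by nra.
  rewrite /W; apply: le_trans (ler_wpM2l _ eg2); last first.
    by rewrite divr_ge0 ?sqr_ge0.
  rewrite le_eqVlt; apply/orP; left; apply/eqP; field.
  by rewrite !gt_eqF.
have Cn : C <= n%:R ^+ 2 by lra.
have := folner_return symS S0 m n0 F'0 F'F cF dF Cn W0 W1.
rewrite -/t /W walkZ -/(dev t) => up.
have x0 : 0 <= C / n%:R ^+ 2 <= 2^-1.
  by rewrite divr_ge0 ?(ltW C0) ?(ltW n2) //= ler_pdivrMr //; lra.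
have low : expR (- (4 * C * K)) <= (1 - C / n%:R ^+ 2) ^+ t.
  apply: (@le_trans _ _ (expR (- (2 * (C / n%:R ^+ 2))) ^+ t)); last first.
    rewrite lerXn2r ?nnegrE ?expR_ge0 ?one_sub_ge_exp //.
    by case/andP: x0; lra.
  rewrite -expRM_natl ler_expR mulrN lerN2.
  have -> : 4 * C * K = 2 * (K * n%:R ^+ 2) * (2 * (C / n%:R ^+ 2)).
    by field; rewrite gt_eqF.
  by rewrite ler_wpM2r // mulr_ge0 //; case/andP: x0.
have h := le_trans low up.
have -> : sigma ^+ 2 * expR (- (4 * C * K)) / (4 * C) * t%:R ^+ 2 =
    expR (- (4 * C * K)) * ((t%:R * sigma) ^+ 2 / (4 * C)).
  by field; rewrite gt_eqF.
have d0 : 0 < (t%:R * sigma) ^+ 2 / (4 * C).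
  by rewrite divr_gt0 ?(exprn_gt0 _ ts0) //; lra.
rewrite mulrC -(ler_pdivlMl _ _ d0).
apply: le_trans h _; rewrite le_eqVlt; apply/orP; left; apply/eqP; field.
by rewrite !gt_eqF.
Qed.

(** Unbounded times at which the variance of the energy is quadratic, converted
    into linear growth of the second moments. The constant [16] is the factor [8] of
    the variance bound, doubled to absorb its bounded term. *)
Lemma ex_linear_growth : controlled_Folner_pairs genS R ->
  exists kappa (t : nat -> nat), [/\ 0 < kappa, forall i, (i < t i)%N &
    forall i, kappa * (t i)%:R <= avg (fun s => moment (t i) (b s))].
Proof.
move=> [C [n [F' [F [noo FP]]]]].
have s0 := drift_gt0.
pose K := 1 + 8 * total * C ^+ 2 / sigma.
have K1 : 1 <= K.
  by rewrite lerDl divr_ge0 ?(ltW s0) // mulr_ge0 ?sqr_ge0 // mulr_ge0 // ltW.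
have KC : 8 * total * C ^+ 2 <= K * sigma.
  have -> : K * sigma = sigma + 8 * total * C ^+ 2.
    by rewrite /K; field; rewrite gt_eqF.
  by rewrite lerDr ltW.
have F'1 : 0 < #|` F' 0|%:R :> R.
  by have [[h _ _] _] := FP 0; rewrite ltr0n cardfs_gt0.
have C0 : 0 < C.
  have [[_ _ F'F] [cF _ _]] := FP 0.
  rewrite -(pmulr_lgt0 _ F'1); apply: lt_le_trans cF.
  by apply: lt_le_trans F'1 _; rewrite ler_nat fsubset_leq_card.
pose c := sigma ^+ 2 * expR (- (4 * C * K)) / (4 * C).
have c0 : 0 < c by rewrite divr_gt0 // mulr_gt0 ?expR_gt0 // exprn_gt0.
exists (c / 16).
suff h i : exists t, (i < t)%N /\ c / 16 * t%:R <= avg (fun s => moment t (b s)).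
  have [t tP] := choice h; exists t; split; first by rewrite divr_gt0.
    by move=> i; have [] := tP i.
  by move=> i; have [] := tP i.
(* A Folner scale at least [N] is large against [i], [2 * C] and the bounded
   term of the variance. *)
pose N := (i + (Num.truncn (2 * C)).+1 + (Num.truncn (4 * step_dev S dot b / c)).+1)%N.
have [j jN] : exists j, (N <= n j)%N.
  have h : (n @ \oo) [set k | (N <= k)%N] by apply: noo; exact: nbhs_infty_ge.
  have [j jN] := @filter_ex _ \oo _ (n @^-1` [set k | (N <= k)%N]) h.
  by exists j.
have [[F'0 F0 F'F] [cF dF ballF]] := FP j.
have n0 : (0 < n j)%N by apply: leq_trans jN; rewrite /N !addnS.
have n1 : 1 <= (n j)%:R :> R by rewrite ler1n.
have nsq : (n j)%:R <= (n j)%:R ^+ 2 :> R by rewrite expr2; nra.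
have [m mP] : exists m, K * (n j)%:R ^+ 2 <= (2 ^ m)%:R <= 2 * (K * (n j)%:R ^+ 2).
  by apply: ex_pow2; nra.
have nt : (n j)%:R <= (2 ^ m)%:R :> R.
  by case/andP: mP => h _; apply: le_trans h; nra.
have trunc_lt (y : R) k : ((Num.truncn y).+1 <= k)%N -> y <= k%:R.
  by move=> h; apply/ltW/(lt_le_trans (truncnS_gt y)); rewrite ler_nat.
have nC : 2 * C <= (n j)%:R ^+ 2.
  apply: le_trans nsq; apply: trunc_lt; apply: leq_trans jN.
  by rewrite /N -addnA addnCA leq_addr.
have step : 4 * step_dev S dot b / c <= (2 ^ m)%:R.
  apply: le_trans nt; apply: trunc_lt; apply: leq_trans jN.
  by rewrite /N leq_addl.
exists (2 ^ m)%N; split.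
  rewrite -(ltr_nat R); apply: lt_le_trans nt; rewrite ltr_nat.
  by apply: leq_trans jN; rewrite /N -addnA addSn addnS ltnS leq_addr.
have := energy_dev_ge n0 F'0 F'F cF dF ballF nC KC K1 mP; rewrite -/c.
set t := (2 ^ m)%N in step nt mP * => low.
have := le_trans low (energy_dev_le symS S0 piP bP harm t).
have t0 : 0 < t%:R :> R by apply: lt_le_trans nt; lra.
have -> : c * t%:R ^+ 2 = t%:R * (c * t%:R) by ring.
rewrite ler_pM2l //.
by move: step; rewrite ler_pdivrMr //; lra.
Qed.

End Growth.

Theorem corollary4p6 (R : realType) (G : groupType) (S : {fset G})
    (symS : symmetric_set S) (genS : generating S) :
  controlled_Folner_pairs genS R -> property_HFD R G.
Proof.
move=> folner V dot pi normE piP [b0 [b0P b0n]].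
have [b [bP harm bpos]] := ex_harmonic symS genS normE piP b0P b0n.
have S0 : S != fset0.
  by apply: contraTneq bpos => ->; rewrite /total_energy big_nil ltxx.
have [kappa [t [k0 t_ge growth]]] :=
  ex_linear_growth symS S0 normE piP bP harm bpos folner.
have [U [UU sU]] := ultraFilterLemma (F := \oo) _.
have tpos i : 0 < (t i)%:R :> R.
  by rewrite ltr0n; apply: leq_ltn_trans (t_ge i).
have lim_ex v : exists a : R,
    (fun i => second_moment S dot b (t i) v / (t i)%:R) @ U --> a.
  apply: (@ultra_bounded_cvg _ _ _ _ (drift S dot b * dot v v)).
  apply: nearW => i; rewrite ger0_norm; last first.
    by rewrite divr_ge0 ?second_moment_ge0 // ltW.
  by rewrite ler_pdivrMr // mulrC (moment_le S0 piP bP harm).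
have [q qP] := choice lim_ex.
exact: (finite_dim_of_limit_form symS genS S0 normE piP bP harm k0 t_ge growth
  UU sU qP).
Qed.
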